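(* Let $\mathcal S_{31}(q)=F_{0,0}(q)+q^2F_{3,31}(q)-q^{22}F_{16,93}(q)$. Then the normalized combination $q^{-1/3}\mathcal S_{31}(q)$ has leading radial amplitude one, i.e. $$e^{\varepsilon/3}\,\mathcal S_{31}(e^{-\varepsilon})\sim e^{4\pi^2/(93\varepsilon)}\qquad(\varepsilon\downarrow 0).$$
   Context: Here $(x;q)_n=\prod_{j=0}^{n-1}(1-xq^j)$ and, for $a,b\in\mathbb Q$ and $0<q<1$, $$F_{a,b}(q)=\sum_{r,s\ge 0}\frac{q^{3r^2+31rs+93s^2+ar+bs}}{(q;q)_r\,(q^{31};q^{31})_s}.$$ The notation $f\sim g$ means $f/g\to1$. *)

(* Defs.v *)
From Stdlib Require Import Reals QArith Qreals.
From Coquelicot Require Import Coquelicot.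
Open Scope R_scope.

(* [(x; q)_n = (1 - x) (1 - x q) ... (1 - x q^(n-1))], with [(x; q)_0 = 1]. *)
Fixpoint qpoch (x q : R) (n : nat) : R :=
  match n with
  | O => 1
  | S m => qpoch x q m * (1 - x * q ^ m)
  end.

(* The exponent may be a negative or non-integral rational, hence [Rpower]
   (meaningful for [0 < q]). *)
Definition F_term (a b : Q) (q : R) (r s : nat) : R :=
  Rpower q (3 * INR r ^ 2 + 31 * INR r * INR s + 93 * INR s ^ 2
            + Q2R a * INR r + Q2R b * INR s)
  / (qpoch q q r * qpoch (q ^ 31) (q ^ 31) s).

(* For [0 < q < 1] all terms are positive and, the quadratic form being
   positive definite, the double series converges; its sum over all pairs
   [(r, s)] is therefore the iterated sum. *)
Definition F (a b : Q) (q : R) : R :=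
  Series (fun r : nat => Series (fun s : nat => F_term a b q r s)).

Definition S31 (q : R) : R :=
  F 0%Q 0%Q q + q ^ 2 * F 3%Q 31%Q q - q ^ 22 * F 16%Q 93%Q q.

(* [f ~ g] as the argument decreases to [0]. *)
Definition equiv_at_0_right (f g : R -> R) : Prop :=
  filterlim (fun e : R => f e / g e) (at_right 0) (locally 1).

(* Main.v *)
Require Import Defs.
From Stdlib Require Import Reals QArith Qreals.
From Stdlib Require Import Lra Lia Psatz.
From Coquelicot Require Import Coquelicot.
Open Scope R_scope.

(** Let (x, y) be the saddle point: 1 - x = x^6 y and 1 - y = x^31 y^6, where
    x^3 - 5 x^2 + 2 x + 1 = 0. Put q = exp (- eps), z = 1 - x and w = 1 - y. The weights
    z^r / (q; q)_r and w^s / (q^31; q^31)_s are proportional to probability laws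
    (of infinite sums of independent geometric variables), and after completing the square
    at the saddle, F_{a,b}(q) is, up to explicit factors, the expectation of
    exp (- eps Q(r - r0, s - s0)) with Q = 3 r^2 + 31 r s + 93 s^2. The expectation converges
    by the central limit theorem, applied first to s and then to r, in Lindeberg's form:
    passing from z to q z, the Gaussian test function is replaced by its heat evolution, with
    an error O(eps^(3/2) z). The normalising sums are treated by the same passage from z to
    q z, which gives log (sum_r z^r / (q; q)_r) = Li2(z) / eps - log (1 - z) / 2 + O(eps).
    Thus F_{a,b} ~ x^a y^(b/31) (5 + x + y - 6 x y)^(-1/2) exp (V / eps) with
    31 V = 31 L(1 - x) + L(1 - y), L being the Rogers dilogarithm. Five-term relations give
    V = 4 pi^2 / 93, and 1 + x^3 y - x^16 y^3 is the square root of 5 + x + y - 6 x y. *)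

(** * The dilogarithm *)

(* Coquelicot equalities often live in a structure convertible to [R]. *)
Ltac as_R := match goal with |- ?l = ?r => change (@eq R l r) end.

(** Tilting by z^r and w^s makes each double series an exact expectation of a Gaussian bounded by 1,
    so that neither tails nor the asymptotics of a single (q; q)_r have to be estimated. The saddle
    equations say that this Gaussian is centred, up to bounded shifts due to a and b, at the
    approximate means - ln x / eps of r and - ln y / (31 eps) of s; elsewhere the expectation would
    be exponentially small. Since s is weighted in base q^31, its mesh is 31 eps. Each passage from
    z q^n to z q^(n+1) costs O(eps^(3/2) q^n) in the expectation and O(eps^2 q^n) in the logarithm
    of the normalising sum; dividing by 1 - q, which is of order eps, leaves O(sqrt eps) and O(eps).
    The exponent V is common to the three series, so only the amplitudes x^a y^(b/31) distinguish
    them. The one transcendental constant behind V is Li2(1) = pi^2 / 6, which enters through the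
    reflection formula. *)

Lemma mean_value_ineq (f f' : R -> R) (a b M : R) :
  (forall x, Rmin a b <= x <= Rmax a b -> is_derive f x (f' x)) ->
  (forall x, Rmin a b <= x <= Rmax a b -> Rabs (f' x) <= M) ->
  Rabs (f b - f a) <= M * Rabs (b - a).
Proof.
intros Hd HM.
destruct (MVT_gen f a b f') as [c [Hc E]].
- intros x Hx; apply Hd; lra.
- intros x Hx; apply continuity_pt_filterlim, (ex_derive_continuous f x).
  now exists (f' x); apply Hd.
- rewrite E, Rabs_mult; apply Rmult_le_compat_r; [apply Rabs_pos|now apply HM].
Qed.

Lemma derive_zero_const (f : R -> R) (a b : R) : a < b ->
  (forall x, a < x < b -> is_derive f x 0) ->
  forall x y, a < x < b -> a < y < b -> f x = f y.
Proof.
intros Hab Hd x y Hx Hy.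
assert (H : Rabs (f x - f y) <= 0 * Rabs (x - y)).
{ apply (mean_value_ineq f (fun _ => 0)).
  - intros t Ht; apply Hd; unfold Rmin, Rmax in Ht; destruct (Rle_dec y x); lra.
  - intros t _; rewrite Rabs_R0; lra. }
rewrite Rmult_0_l in H; generalize (Rabs_pos (f x - f y)); intro H'.
assert (E : Rabs (f x - f y) = 0) by lra.
apply Rabs_eq_0 in E; lra.
Qed.

Lemma CV_radius_one : CV_radius (fun _ : nat => 1) = 1.
Proof.
rewrite (CV_radius_finite_DAlembert _ 1); [now rewrite Rinv_1|intro; lra|lra|].
apply is_lim_seq_ext with (fun _ : nat => 1); [|apply is_lim_seq_const].
intro n; unfold Rdiv; rewrite Rinv_1, Rmult_1_r, Rabs_R1; reflexivity.
Qed.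

(** The coefficients 1 / n and, below, 1 / n^2 (zero at n = 0) are written as formal integrals, so
    that radius and derivative follow from general laws; [PS_decr_1] divides the logarithm series by
    x. *)
Definition log_coef : nat -> R := PS_Int (fun _ => 1).
Definition Li2_coef : nat -> R := PS_Int (PS_decr_1 log_coef).
Definition Li2 (x : R) : R := PSeries Li2_coef x.

Lemma CV_radius_log : CV_radius log_coef = 1.
Proof. unfold log_coef; rewrite CV_radius_Int; apply CV_radius_one. Qed.

Lemma CV_radius_Li2 : CV_radius Li2_coef = 1.
Proof. unfold Li2_coef; rewrite CV_radius_Int, CV_radius_decr_1; apply CV_radius_log. Qed.

Lemma in_unit_disk (x : R) : -1 < x < 1 -> Rbar_lt (Rabs x) 1.
Proof. intro H; simpl; apply Rabs_def1; lra. Qed.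

Lemma PS_derive_Int (a : nat -> R) (n : nat) : PS_derive (PS_Int a) n = a n.
Proof.
unfold PS_derive, PS_Int; simpl pred; field; apply not_0_INR; lia.
Qed.

Lemma log_series (x : R) : -1 < x < 1 -> PSeries log_coef x = - ln (1 - x).
Proof.
intros Hx.
enough (E : PSeries log_coef x + ln (1 - x) = PSeries log_coef 0 + ln (1 - 0)).
{ rewrite PSeries_0, Rminus_0_r, ln_1 in E; change (log_coef 0) with 0 in E; lra. }
apply (derive_zero_const (fun x => PSeries log_coef x + ln (1 - x)) (-1) 1); [lra| |lra|lra].
intros t Ht.
replace 0 with (plus (/ (1 - t)) (- / (1 - t))) by (unfold plus; simpl; ring).
apply (is_derive_plus (PSeries log_coef) (fun t => ln (1 - t))).
- replace (/ (1 - t)) with (PSeries (PS_derive log_coef) t).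
  + apply is_derive_PSeries; rewrite CV_radius_log; now apply in_unit_disk.
  + rewrite <- Series_geom by (apply Rabs_def1; lra).
    apply Series_ext; intro n; unfold log_coef; rewrite PS_derive_Int; ring.
- auto_derive; [lra|]; field; lra.
Qed.

Lemma is_derive_Li2 (x : R) : 0 < x < 1 -> is_derive Li2 x (- ln (1 - x) / x).
Proof.
intros Hx; replace (- ln (1 - x) / x) with (PSeries (PS_derive Li2_coef) x).
- apply is_derive_PSeries; rewrite CV_radius_Li2; apply in_unit_disk; lra.
- rewrite <- log_series by lra.
  rewrite (PSeries_decr_1_aux log_coef x) by reflexivity.
  rewrite (PSeries_ext _ (PS_decr_1 log_coef) x) by (intro; apply PS_derive_Int).
  field; lra.
Qed.

Lemma Li2_0 : Li2 0 = 0.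
Proof. unfold Li2; now rewrite PSeries_0. Qed.

Lemma continuous_Li2 (x : R) : -1 < x < 1 -> continuous Li2 x.
Proof.
intros Hx; apply continuity_pt_filterlim, PSeries_continuity.
rewrite CV_radius_Li2; now apply in_unit_disk.
Qed.

(** * The Basel sum from Wallis integrals *)

Definition Wallis_I (n : nat) : R := RInt (fun x => cos x ^ (2 * n)) 0 (PI / 2).
Definition Wallis_J (n : nat) : R := RInt (fun x => x ^ 2 * cos x ^ (2 * n)) 0 (PI / 2).

Lemma ex_RInt_derivable (f : R -> R) (a b : R) :
  (forall x, ex_derive f x) -> ex_RInt f a b.
Proof.
intro H; apply (ex_RInt_continuous (V := R_CompleteNormedModule)).
intros z _; apply (ex_derive_continuous f z), H.
Qed.

Lemma ex_Wallis_I (n : nat) (a b : R) : ex_RInt (fun x => cos x ^ n) a b.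
Proof. apply ex_RInt_derivable; intro x; auto_derive; trivial. Qed.

Lemma ex_Wallis_J (n : nat) (a b : R) : ex_RInt (fun x => x ^ 2 * cos x ^ n) a b.
Proof. apply ex_RInt_derivable; intro x; auto_derive; trivial. Qed.

Lemma RInt_derive_eq (f df : R -> R) (a b : R) :
  (forall x, is_derive f x (df x)) -> (forall x, ex_derive df x) ->
  RInt df a b = f b - f a.
Proof.
intros Hf Hd; apply is_RInt_unique, (is_RInt_derive f df).
- intros x _; apply Hf.
- intros x _; apply (ex_derive_continuous df x), Hd.
Qed.

Lemma sin2_of_cos2 (x : R) : sin x ^ 2 = 1 - cos x ^ 2.
Proof. generalize (sin2_cos2 x); unfold Rsqr; nra. Qed.

Lemma RInt_lin2 (f g : R -> R) (c d a b : R) : ex_RInt f a b -> ex_RInt g a b ->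
  RInt (fun x => c * f x + d * g x) a b = c * RInt f a b + d * RInt g a b.
Proof.
intros Hf Hg; apply is_RInt_unique.
apply (is_RInt_plus (fun x => c * f x) (fun x => d * g x)).
- apply (is_RInt_scal f a b c), (RInt_correct (V := R_CompleteNormedModule)), Hf.
- apply (is_RInt_scal g a b d), (RInt_correct (V := R_CompleteNormedModule)), Hg.
Qed.

Lemma Wallis_I_rec (n : nat) :
  (2 * INR n + 2) * Wallis_I (S n) = (2 * INR n + 1) * Wallis_I n.
Proof.
unfold Wallis_I.
enough (E : (2 * INR n + 2) * RInt (fun x => cos x ^ (2 * S n)) 0 (PI / 2) +
  (- (2 * INR n + 1)) * RInt (fun x => cos x ^ (2 * n)) 0 (PI / 2) = 0) by lra.
rewrite <- RInt_lin2 by apply ex_Wallis_I.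
rewrite (RInt_derive_eq (fun x => sin x * cos x ^ (2 * n + 1))).
- rewrite sin_0, cos_PI2, pow_i by lia; ring.
- intro x; auto_derive; [trivial|].
  replace (2 * S n)%nat with (S (S (2 * n))) by lia.
  replace (n + (n + 0) + 1)%nat with (S (2 * n)) by lia.
  rewrite Nat.pred_succ, S_INR, mult_INR; simpl (INR 2); rewrite <- !tech_pow_Rmult.
  transitivity (cos x * (cos x * cos x ^ (2 * n)) - sin x ^ 2 * (2 * INR n + 1) * cos x ^ (2 * n)).
  + ring.
  + rewrite sin2_of_cos2; ring.
- intro x; auto_derive; trivial.
Qed.

Lemma Wallis_J_rec (n : nat) :
  Wallis_I (S n) + (INR n + 1) * ((2 * INR n + 2) * Wallis_J (S n)
    - (2 * INR n + 1) * Wallis_J n) = 0.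
Proof.
unfold Wallis_I, Wallis_J.
transitivity (1 * RInt (fun x => cos x ^ (2 * S n)) 0 (PI / 2) +
  (INR n + 1) * RInt (fun x => (2 * INR n + 2) * (x ^ 2 * cos x ^ (2 * S n))
     + (- (2 * INR n + 1)) * (x ^ 2 * cos x ^ (2 * n))) 0 (PI / 2)).
{ rewrite RInt_lin2 by apply ex_Wallis_J; ring. }
rewrite <- RInt_lin2; [|apply ex_Wallis_I|apply ex_RInt_derivable; intro x; auto_derive; trivial].
(* This antiderivative vanishes at both ends, and in its derivative the two terms in x sin x
   cos^(2n+1) x cancel. *)
rewrite (RInt_derive_eq (fun x => x * cos x ^ (2 * S n)
   + (INR n + 1) * (x ^ 2 * (sin x * cos x ^ (2 * n + 1))))).
- rewrite sin_0, cos_PI2, !pow_i by lia; ring.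
- intro x; auto_derive; [trivial|].
  replace (2 * S n)%nat with (S (S (2 * n))) by lia.
  replace (n + (n + 0) + 1)%nat with (S (2 * n)) by lia.
  replace (n + S (n + 0))%nat with (S (2 * n)) by lia.
  rewrite Nat.pred_succ; cbv iota; rewrite S_INR, mult_INR; simpl (INR 2); rewrite <- !tech_pow_Rmult.
  match goal with |- ?l = ?r =>
    enough (H : l - r = (INR n + 1) * x ^ 2 * cos x ^ (2 * n) * (2 * INR n + 1)
      * (1 - cos x ^ 2 - sin x ^ 2)) end.
  + rewrite sin2_of_cos2 in H; apply Rminus_diag_uniq; rewrite H; ring.
  + ring.
- intro x; auto_derive; trivial.
Qed.

Lemma Wallis_I_0 : Wallis_I 0 = PI / 2.
Proof.
unfold Wallis_I; rewrite (RInt_ext _ (fun _ => 1)) by (intros; reflexivity).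
rewrite RInt_const; unfold scal; simpl; unfold mult; simpl; ring.
Qed.

Lemma Wallis_I_pos (n : nat) : 0 < Wallis_I n.
Proof.
induction n as [|n IH].
- rewrite Wallis_I_0; generalize PI_RGT_0; lra.
- assert (H := Wallis_I_rec n); assert (H0 := pos_INR n).
  apply Rmult_lt_reg_l with (2 * INR n + 2); [lra|]; rewrite H; nra.
Qed.

Lemma x_cos_le_sin (x : R) : 0 <= x <= PI / 2 -> x * cos x <= sin x.
Proof.
intros Hx.
destruct (MVT_gen (fun x => sin x - x * cos x) 0 x (fun x => x * sin x)) as [c [Hc E]].
- intros t _; auto_derive; [trivial|ring].
- intros t _; apply continuity_pt_filterlim, (ex_derive_continuous (fun x => sin x - x * cos x)).
  auto_derive; trivial.
- rewrite sin_0 in E.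
  rewrite Rmin_left, Rmax_right in Hc by lra.
  assert (0 <= sin c) by (apply sin_ge_0; generalize PI_RGT_0; lra).
  enough (0 <= c * sin c * (x - 0)) by lra.
  apply Rmult_le_pos; [apply Rmult_le_pos|]; lra.
Qed.

(** By x cos x <= sin x, the integrand x^2 cos^(2n+2) x is at most sin^2 x cos^(2n) x, whose
    integral is [Wallis_I n - Wallis_I (S n)]. *)
Lemma Wallis_J_bound (n : nat) :
  0 <= Wallis_J (S n) <= Wallis_I (S n) / (2 * INR n + 1).
Proof.
assert (HP := PI_RGT_0).
replace (Wallis_I (S n) / (2 * INR n + 1)) with (Wallis_I n - Wallis_I (S n)).
2:{ assert (H := Wallis_I_rec n); assert (H0 := pos_INR n).
    apply Rmult_eq_reg_r with (2 * INR n + 1); [|lra]. field_simplify; lra. }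
assert (E : Wallis_I n - Wallis_I (S n) =
   RInt (fun x => 1 * cos x ^ (2 * n) + (-1) * cos x ^ (2 * S n)) 0 (PI / 2)).
{ rewrite RInt_lin2 by apply ex_Wallis_I; unfold Wallis_I; ring. }
rewrite E; unfold Wallis_J; split.
- apply RInt_ge_0; [lra|apply ex_Wallis_J|].
  intros x Hx; apply Rmult_le_pos; [apply pow2_ge_0|].
  rewrite pow_mult; apply pow_le, pow2_ge_0.
- apply RInt_le; [lra|apply ex_Wallis_J| |].
  + apply ex_RInt_derivable; intro x; auto_derive; trivial.
  + intros x Hx.
    assert (H1 : x * cos x <= sin x) by (apply x_cos_le_sin; lra).
    assert (H2 : 0 <= cos x) by (apply cos_ge_0; lra).
    assert (H3 : 0 <= cos x ^ (2 * n)) by now apply pow_le.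
    replace (2 * S n)%nat with (2 * n + 2)%nat by lia; rewrite pow_add.
    assert (H4 := sin2_of_cos2 x).
    assert (H5 : (x * cos x) ^ 2 <= sin x ^ 2).
    { apply pow_incr; split; [apply Rmult_le_pos; lra|exact H1]. }
    nra.
Qed.

(** The two recurrences make 1 / (n + 1)^2 twice a difference of consecutive quotients J / I. The
    sum telescopes from J_0 / I_0 = pi^2 / 12, and the quotients tend to 0 by [Wallis_J_bound]. *)
Lemma Basel : is_series (fun n => / (INR n + 1) ^ 2) (PI ^ 2 / 6).
Proof.
assert (Hs : forall n, / (INR n + 1) ^ 2 =
  2 * (Wallis_J n / Wallis_I n) - 2 * (Wallis_J (S n) / Wallis_I (S n))).
{ intro n.
  assert (H := Wallis_I_rec n); assert (H0 := pos_INR n); assert (H1 := Wallis_I_pos n).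
  assert (H2 := Wallis_I_pos (S n)); assert (H3 := Wallis_J_rec n).
  assert (E : Wallis_I n = (2 * INR n + 2) * Wallis_I (S n) / (2 * INR n + 1)).
  { apply Rmult_eq_reg_l with (2 * INR n + 1); [|lra]; rewrite <- H; field; lra. }
  assert (E2 : Wallis_J n = (Wallis_I (S n) / (INR n + 1) + (2 * INR n + 2) * Wallis_J (S n)) / (2 * INR n + 1)).
  { apply Rmult_eq_reg_l with ((2 * INR n + 1) * (INR n + 1)); [|nra].
    transitivity (Wallis_I (S n) + (INR n + 1) * ((2 * INR n + 2) * Wallis_J (S n)));
      [lra|field; lra]. }
  rewrite E, E2; field; lra. }
assert (H0 : 2 * (Wallis_J 0 / Wallis_I 0) = PI ^ 2 / 6).
{ rewrite Wallis_I_0; unfold Wallis_J.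
  rewrite (RInt_ext _ (fun x => x ^ 2)) by (intros; simpl; ring).
  rewrite (RInt_derive_eq (fun x => x ^ 3 / 3)).
  - field; apply PI_neq0.
  - intro x; auto_derive; [trivial|field].
  - intro x; auto_derive; trivial. }
assert (Hsum : forall n, sum_n (fun n => / (INR n + 1) ^ 2) n =
   PI ^ 2 / 6 - 2 * (Wallis_J (S n) / Wallis_I (S n))).
{ induction n as [|n IH].
  - rewrite sum_O, Hs, H0; reflexivity.
  - rewrite sum_Sn, IH, Hs; unfold plus; simpl.
    as_R; ring. }
apply (is_lim_seq_ext (fun n => PI ^ 2 / 6 - 2 * (Wallis_J (S n) / Wallis_I (S n))) _ (PI ^ 2 / 6));
  [intro; symmetry; apply Hsum|].
replace (Finite (PI ^ 2 / 6)) with (Finite (PI ^ 2 / 6 - 2 * 0)) by (f_equal; ring).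
apply is_lim_seq_minus'; [apply is_lim_seq_const|].
apply (is_lim_seq_scal_l _ 2 0).
apply is_lim_seq_le_le with (fun _ => 0) (fun n => / (INR n + 1)).
- intro n; assert (Hb := Wallis_J_bound n); assert (H2 := Wallis_I_pos (S n)).
  assert (H3 := pos_INR n).
  split; [apply Rdiv_le_0_compat; lra|].
  apply Rle_trans with (/ (2 * INR n + 1)).
  + apply Rmult_le_reg_r with (Wallis_I (S n)); [lra|].
    unfold Rdiv; rewrite Rmult_assoc, Rinv_l, Rmult_1_r by lra.
    rewrite Rmult_comm; apply Hb.
  + apply Rinv_le_contravar; lra.
- apply is_lim_seq_const.
- apply is_lim_seq_ext with (fun n => / INR (S n)); [intro; now rewrite S_INR|].
  apply (is_lim_seq_incr_1 (fun n => / INR n)).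
  replace (Finite 0) with (Rbar_inv p_infty) by reflexivity.
  apply is_lim_seq_inv; [apply is_lim_seq_INR|discriminate].
Qed.

Lemma Li2_lim_1 : filterlim Li2 (at_left 1) (locally (PI ^ 2 / 6)).
Proof.
assert (Hs : is_series Li2_coef (PI ^ 2 / 6)).
{ apply is_series_decr_1.
  match goal with |- is_series _ ?l => replace l with (PI ^ 2 / 6) end.
  2:{ unfold plus, opp; simpl; as_R.
      unfold Li2_coef, PS_Int; simpl; ring. }
  apply is_series_ext with (2 := Basel).
  intro n; unfold Li2_coef, PS_Int, PS_decr_1, log_coef, PS_Int.
  simpl pred; rewrite S_INR; as_R; field; generalize (pos_INR n); lra. }
assert (Hp : is_pseries Li2_coef 1 (PI ^ 2 / 6)).
{ apply is_series_ext with (2 := Hs); intro n.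
  rewrite pow_n_pow, pow1; unfold scal; simpl; unfold mult; simpl; as_R; ring. }
replace (PI ^ 2 / 6) with (PSeries Li2_coef 1) by now apply is_pseries_unique.
assert (A := Abel Li2_coef); rewrite CV_radius_Li2 in A; simpl in A.
apply A; [lra|trivial|now exists (PI ^ 2 / 6)].
Qed.

Lemma filterlim_squeeze {T : Type} (F : (T -> Prop) -> Prop) {FF : Filter F}
  (f g : T -> R) (l : R) :
  F (fun x => Rabs (f x - l) <= g x) -> filterlim g F (locally 0) ->
  filterlim f F (locally l).
Proof.
intros Hfg Hg; apply filterlim_locally; intro eps.
assert (H := proj1 (filterlim_locally g 0) Hg eps).
generalize (filter_and _ _ Hfg H); apply filter_imp; intros x [H1 H2].
revert H2; unfold ball; simpl; unfold AbsRing_ball, abs, minus, plus, opp; simpl.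
rewrite Ropp_0, Rplus_0_r; intro H2.
apply Rabs_def2 in H2; unfold Rminus in H1; lra.
Qed.

Lemma filterlim_Rplus {T : Type} (F : (T -> Prop) -> Prop) {FF : Filter F}
  (f g : T -> R) (l m : R) : filterlim f F (locally l) -> filterlim g F (locally m) ->
  filterlim (fun x => f x + g x) F (locally (l + m)).
Proof.
intros Hf Hg; apply (filterlim_comp_2 f g Rplus Hf Hg), (filterlim_plus (V := R_NormedModule) l m).
Qed.

Lemma filterlim_Rmult {T : Type} (F : (T -> Prop) -> Prop) {FF : Filter F}
  (f g : T -> R) (l m : R) : filterlim f F (locally l) -> filterlim g F (locally m) ->
  filterlim (fun x => f x * g x) F (locally (l * m)).
Proof.
intros Hf Hg; apply (filterlim_comp_2 f g Rmult Hf Hg), (filterlim_mult (K := R_AbsRing) l m).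
Qed.

(** From ln v <= v - 1 at v = 1 / sqrt u. It makes ln t ln (1 - t) vanish like sqrt (1 - t) as t
    tends to 1. *)
Lemma neg_ln_le_sqrt (u : R) : 0 < u <= 1 -> 0 <= - ln u <= 2 / sqrt u.
Proof.
intros Hu.
assert (Hs : 0 < sqrt u) by (apply sqrt_lt_R0; lra).
assert (E : ln u = 2 * ln (sqrt u)).
{ rewrite <- (sqrt_sqrt u) at 1 by lra; rewrite ln_mult by assumption; ring. }
assert (H0 : ln u <= 0) by (rewrite <- ln_1; apply ln_le; lra).
split; [lra|].
assert (H : ln (/ sqrt u) <= / sqrt u - 1).
{ assert (Hi : 0 < / sqrt u) by now apply Rinv_0_lt_compat.
  generalize (exp_ineq1_le (ln (/ sqrt u))); rewrite exp_ln by assumption; lra. }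
rewrite ln_Rinv in H by assumption.
rewrite E; unfold Rdiv; lra.
Qed.

Lemma neg_ln_1_minus (u : R) : 0 <= u < 1 -> 0 <= - ln (1 - u) <= u / (1 - u).
Proof.
intros Hu.
assert (H0 : ln (1 - u) <= 0) by (rewrite <- ln_1; apply ln_le; lra).
split; [lra|].
assert (Hi : 0 < / (1 - u)) by (apply Rinv_0_lt_compat; lra).
generalize (exp_ineq1_le (ln (/ (1 - u)))); rewrite exp_ln by assumption.
rewrite ln_Rinv by lra.
replace (u / (1 - u)) with (/ (1 - u) - 1) by (field; lra); lra.
Qed.

Lemma Derive_Li2 (x : R) : 0 < x < 1 -> Derive (fun t : R => Li2 t) x = - ln (1 - x) / x.
Proof. intro H; apply is_derive_unique; now apply is_derive_Li2. Qed.

Lemma ex_derive_Li2 (x : R) : 0 < x < 1 -> ex_derive (fun t : R => Li2 t) x.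
Proof. intro H; exists (- ln (1 - x) / x); now apply is_derive_Li2. Qed.

(** The left-hand side has zero derivative; its constant value is read off from [Li2_lim_1] as x
    tends to 1 from below. *)
Lemma Li2_reflection (x : R) : 0 < x < 1 ->
  Li2 x + Li2 (1 - x) + ln x * ln (1 - x) = PI ^ 2 / 6.
Proof.
intros Hx.
pose (f := fun x => Li2 x + Li2 (1 - x) + ln x * ln (1 - x)).
change (f x = PI ^ 2 / 6).
assert (Hf : forall t, 0 < t < 1 -> f t = f x).
{ intros t Ht; apply (derive_zero_const f 0 1); [lra| |exact Ht|exact Hx].
  clear; intros t Ht; unfold f; auto_derive.
  - repeat split; try lra; apply ex_derive_Li2; lra.
  - change (1 + - t) with (1 - t); rewrite (Derive_Li2 t), (Derive_Li2 (1 - t)) by lra.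
    replace (1 - (1 - t)) with t by ring; field; lra. }
assert (Hl : at_left 1 (fun t => 0 < t < 1)).
{ exists (mkposreal 1 Rlt_0_1); intros t Ht Ht1.
  unfold ball in Ht; simpl in Ht; unfold AbsRing_ball, abs, minus, plus, opp in Ht; simpl in Ht.
  apply Rabs_def2 in Ht; lra. }
apply (filterlim_locally_unique (F := at_left 1) f).
- apply filterlim_ext_loc with (fun _ => f x); [|apply filterlim_const].
  revert Hl; apply filter_imp; intros t Ht; symmetry; now apply Hf.
- apply (filterlim_squeeze (at_left 1) f (fun t => Rabs (Li2 t - PI ^ 2 / 6) + Rabs (Li2 (1 - t)) + 2 * sqrt (1 - t) / t)).
  + revert Hl; apply filter_imp; intros t Ht; unfold f.
    assert (H : Rabs (ln t * ln (1 - t)) <= 2 * sqrt (1 - t) / t).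
    { assert (H1 := neg_ln_le_sqrt (1 - t)).
      assert (H2 := neg_ln_1_minus (1 - t)); replace (1 - (1 - t)) with t in H2 by ring.
      assert (Hs : 0 < sqrt (1 - t)) by (apply sqrt_lt_R0; lra).
      replace (ln t * ln (1 - t)) with ((- ln t) * (- ln (1 - t))) by ring.
      rewrite Rabs_pos_eq by (apply Rmult_le_pos; lra).
      apply Rle_trans with ((1 - t) / t * (2 / sqrt (1 - t))); [apply Rmult_le_compat; lra|].
      right; rewrite <- (sqrt_sqrt (1 - t)) at 1 by lra; field; lra. }
    replace (_ - _) with ((Li2 t - PI ^ 2 / 6) + Li2 (1 - t) + ln t * ln (1 - t)) by ring.
    eapply Rle_trans; [apply Rabs_triang|]; apply Rplus_le_compat; [apply Rabs_triang|exact H].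
  + replace 0 with (Rabs (PI ^ 2 / 6 - PI ^ 2 / 6) + Rabs (Li2 (1 - 1)) + 2 * sqrt (1 - 1) / 1)
      by (rewrite !Rminus_diag, Li2_0, Rabs_R0, sqrt_0; field).
    assert (Hc : forall h : R -> R, continuous h 1 -> filterlim h (at_left 1) (locally (h 1))).
    { intros h Hh; apply filterlim_filter_le_1 with (2 := Hh); apply filter_le_within. }
    assert (C1 : filterlim (fun t => Rabs (Li2 t - PI ^ 2 / 6)) (at_left 1) (locally (Rabs (PI ^ 2 / 6 - PI ^ 2 / 6)))).
    { apply (filterlim_comp _ _ _ Li2 (fun v => Rabs (v - PI ^ 2 / 6)) _ _ _ Li2_lim_1).
      apply (continuous_comp (fun v => v - PI ^ 2 / 6) Rabs).
      - apply (ex_derive_continuous (fun v => v - PI ^ 2 / 6)); auto_derive; trivial.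
      - apply continuous_Rabs. }
    assert (C2 : filterlim (fun t => Rabs (Li2 (1 - t))) (at_left 1) (locally (Rabs (Li2 (1 - 1))))).
    { apply (Hc (fun t => Rabs (Li2 (1 - t)))).
      apply (continuous_comp (fun t => Li2 (1 - t)) Rabs); [|apply continuous_Rabs].
      apply (continuous_comp (fun t => 1 - t) Li2).
      - apply (ex_derive_continuous (fun t => 1 - t)); auto_derive; trivial.
      - apply continuous_Li2; lra. }
    assert (C3 : filterlim (fun t => 2 * sqrt (1 - t) / t) (at_left 1) (locally (2 * sqrt (1 - 1) / 1))).
    { apply (Hc (fun t => 2 * sqrt (1 - t) / t)).
      apply (continuous_mult (fun t => 2 * sqrt (1 - t)) (fun t => / t)).
      - apply (continuous_comp (fun t => 1 - t) (fun v => 2 * sqrt v)).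
        + apply (ex_derive_continuous (fun t => 1 - t)); auto_derive; trivial.
        + apply (continuous_scal_r 2 sqrt), continuous_sqrt.
      - apply (ex_derive_continuous (fun t => / t)); auto_derive; lra. }
    exact (filterlim_Rplus _ _ _ _ _ (filterlim_Rplus _ _ _ _ _ C1 C2) C3).
Qed.

(** For fixed b the difference of the two sides has zero derivative in a and vanishes at a = 0. The
    derivative formula for [Li2] holds on the open interval, so the mean value theorem is used with
    mere continuity at 0. *)
Lemma Li2_five_term (a b : R) : 0 < a < 1 -> 0 < b < 1 ->
  Li2 a + Li2 b - Li2 (a * b) - Li2 (a * (1 - b) / (1 - a * b))
    - Li2 (b * (1 - a) / (1 - a * b))
  = (ln (1 - a) - ln (1 - a * b)) * (ln (1 - b) - ln (1 - a * b)).
Proof.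
intros Ha Hb.
pose (f := fun a => Li2 a + Li2 b - Li2 (a * b) - Li2 (a * (1 - b) / (1 - a * b))
    - Li2 (b * (1 - a) / (1 - a * b))
    - (ln (1 - a) - ln (1 - a * b)) * (ln (1 - b) - ln (1 - a * b))).
enough (E : f a - f 0 = 0).
{ unfold f in E.
  replace (0 * b) with 0 in E by ring.
  replace (0 * (1 - b) / (1 - 0)) with 0 in E by field.
  replace (b * (1 - 0) / (1 - 0)) with b in E by field.
  rewrite Rminus_0_r, ln_1, Li2_0 in E; lra. }
assert (Hin : forall t, 0 <= t < 1 -> 0 <= t * b < 1) by (intros; nra).
assert (Hin' : forall t, 0 < t < 1 -> 0 < t * b) by (intros; nra).
assert (Hc : forall t, 0 <= t < 1 -> 0 <= t * (1 - b) / (1 - t * b) < 1).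
{ intros t Ht; specialize (Hin t Ht); split.
  - apply Rdiv_le_0_compat; nra.
  - apply Rmult_lt_reg_r with (1 - t * b); [lra|]; unfold Rdiv; rewrite Rmult_assoc, Rinv_l by lra; nra. }
assert (Hd : forall t, 0 <= t < 1 -> 0 < b * (1 - t) / (1 - t * b) < 1).
{ intros t Ht; specialize (Hin t Ht); split.
  - apply Rdiv_lt_0_compat; nra.
  - apply Rmult_lt_reg_r with (1 - t * b); [lra|]; unfold Rdiv; rewrite Rmult_assoc, Rinv_l by lra; nra. }
destruct (MVT_gen f 0 a (fun _ => 0)) as [c [_ E]].
- rewrite Rmin_left, Rmax_right by lra; intros t Ht.
  assert (H1 := Hin t); assert (H2 := Hc t); assert (H3 := Hd t); assert (H4 := Hin' t).
  assert (H5 : 0 < t * (1 - b) / (1 - t * b)) by (apply Rdiv_lt_0_compat; nra).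
  assert (Hc' : 0 < t * (1 - b) * / (1 + - (t * b)) < 1) by (split; [exact H5|apply H2; lra]).
  assert (Hd' : 0 < b * (1 + - t) * / (1 + - (t * b)) < 1) by (apply H3; lra).
  unfold f; auto_derive.
  + repeat split; try lra; apply ex_derive_Li2; (exact Hc' || exact Hd' || lra).
  + rewrite (Derive_Li2 t), (Derive_Li2 (t * b)), (Derive_Li2 _ Hc'), (Derive_Li2 _ Hd') by lra.
    replace (1 - t * (1 - b) * / (1 + - (t * b))) with ((1 - t) / (1 - t * b)) by (field; lra).
    replace (1 - b * (1 + - t) * / (1 + - (t * b))) with ((1 - b) / (1 - t * b)) by (field; lra).
    rewrite !ln_div by lra.
    unfold Rminus.
    field; lra.
- rewrite Rmin_left, Rmax_right by lra; intros t Ht.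
  assert (H1 := Hin t); assert (H2 := Hc t); assert (H3 := Hd t).
  apply continuity_pt_filterlim.
  assert (Cab : ex_derive (fun t => t * b) t) by (auto_derive; trivial).
  assert (Cc : ex_derive (fun t => t * (1 - b) / (1 - t * b)) t) by (auto_derive; lra).
  assert (Cd : ex_derive (fun t => b * (1 - t) / (1 - t * b)) t) by (auto_derive; lra).
  assert (Cl : ex_derive (fun t => (ln (1 - t) - ln (1 - t * b)) * (ln (1 - b) - ln (1 - t * b))) t)
    by (auto_derive; repeat split; lra).
  assert (CL : forall g : R -> R, ex_derive g t -> -1 < g t < 1 -> continuous (fun t => Li2 (g t)) t).
  { intros g Hg Hgt; apply (continuous_comp g Li2).
    - now apply (ex_derive_continuous g).
    - now apply continuous_Li2. }
  apply (continuous_minus (fun t => Li2 t + Li2 b - Li2 (t * b) - Li2 (t * (1 - b) / (1 - t * b))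
    - Li2 (b * (1 - t) / (1 - t * b)))); [|now apply (ex_derive_continuous (fun t => (ln (1 - t) - ln (1 - t * b)) * (ln (1 - b) - ln (1 - t * b))))].
  apply (continuous_minus (fun t => Li2 t + Li2 b - Li2 (t * b) - Li2 (t * (1 - b) / (1 - t * b)))); [|apply (CL _ Cd); lra].
  apply (continuous_minus (fun t => Li2 t + Li2 b - Li2 (t * b))); [|apply (CL _ Cc); lra].
  apply (continuous_minus (fun t => Li2 t + Li2 b)); [|apply (CL _ Cab); lra].
  apply (continuous_plus Li2); [apply continuous_Li2; lra|apply continuous_const].
- lra.
Qed.

(** * The Rogers dilogarithm and its value at the saddle *)

Definition rogers (x : R) : R := Li2 x + ln x * ln (1 - x) / 2.

Lemma rogers_reflection (x : R) : 0 < x < 1 -> rogers x + rogers (1 - x) = PI ^ 2 / 6.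
Proof.
intro Hx; unfold rogers; rewrite <- (Li2_reflection x Hx).
replace (1 - (1 - x)) with x by ring; field.
Qed.

(** The half-products of logarithms absorb the elementary side of [Li2_five_term]. The arguments [c]
    and [d] are given by equations free of division, so that instances can be checked by polynomial
    arithmetic modulo the cubic. *)
Lemma rogers_five_term (a b c d : R) : 0 < a < 1 -> 0 < b < 1 ->
  c * (1 - a * b) = a * (1 - b) -> d * (1 - a * b) = b * (1 - a) ->
  rogers a + rogers b = rogers (a * b) + rogers c + rogers d.
Proof.
intros Ha Hb Hc Hd.
assert (Hab : 0 < a * b < 1) by nra.
assert (Ec : c = a * (1 - b) / (1 - a * b)).
{ apply Rmult_eq_reg_r with (1 - a * b); [|lra]; rewrite Hc; field; lra. }
assert (Ed : d = b * (1 - a) / (1 - a * b)).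
{ apply Rmult_eq_reg_r with (1 - a * b); [|lra]; rewrite Hd; field; lra. }
assert (H := Li2_five_term a b Ha Hb).
rewrite <- Ec, <- Ed in H.
assert (Lc : ln c = ln a + ln (1 - b) - ln (1 - a * b)).
{ rewrite Ec, ln_div, ln_mult by nra; ring. }
assert (Ld : ln d = ln b + ln (1 - a) - ln (1 - a * b)).
{ rewrite Ed, ln_div, ln_mult by nra; ring. }
assert (Lc' : ln (1 - c) = ln (1 - a) - ln (1 - a * b)).
{ rewrite Ec; replace (1 - _ / _) with ((1 - a) / (1 - a * b)) by (field; lra).
  now rewrite ln_div by lra. }
assert (Ld' : ln (1 - d) = ln (1 - b) - ln (1 - a * b)).
{ rewrite Ed; replace (1 - _ / _) with ((1 - b) / (1 - a * b)) by (field; lra).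
  now rewrite ln_div by lra. }
unfold rogers; rewrite Lc, Ld, Lc', Ld', ln_mult by lra.
lra.
Qed.

Lemma rogers_five_term_mult (a b e c d : R) : 0 < a < 1 -> 0 < b < 1 -> e = a * b ->
  c * (1 - e) = a * (1 - b) -> d * (1 - e) = b * (1 - a) ->
  rogers a + rogers b = rogers e + rogers c + rogers d.
Proof. intros Ha Hb -> Hc Hd; now apply rogers_five_term. Qed.

(** The new variable is opaque and carries its defining equation: [rogers r] is an atom for [lra],
    and the value is substituted only in side conditions. *)
Ltac abbreviate_real r t := destruct (ex_intro (fun v : R => v = t) t eq_refl) as [r ?].

Ltac rogers_reflect r :=
  assert (rogers r + rogers (1 - r) = PI ^ 2 / 6) by (apply rogers_reflection; subst; lra).

Ltac rogers_five a b e c d :=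
  assert (rogers a + rogers b = rogers e + rogers c + rogers d)
    by (apply rogers_five_term_mult; subst; lra).

(** Eliminating y from the saddle equations leaves (x^2 - x + 1)^2 (x^3 - 5 x^2 + 2 x + 1) = 0,
    whose first factor has no real root. The enclosure is narrow because numbers such as 1 - y,
    about 0.0004, are polynomials in x whose large terms nearly cancel, and they must be placed in
    (0, 1). *)
Lemma saddle_exists : exists x, 0.77812383773680 < x < 0.77812383773681 /\
  x ^ 3 = 5 * x ^ 2 - 2 * x - 1.
Proof.
destruct (IVT (fun x => - (x ^ 3 - 5 * x ^ 2 + 2 * x + 1)) 0.77812383773680 0.77812383773681)
  as [x [Hx E]]; [|lra|lra|lra|].
- intros x; apply continuity_pt_filterlim,
    (ex_derive_continuous (fun x => - (x ^ 3 - 5 * x ^ 2 + 2 * x + 1))); auto_derive; trivial.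
- exists x; split; [|lra].
  split; apply Rnot_le_lt; intro H.
  + assert (x = 0.77812383773680) by lra; subst; lra.
  + assert (x = 0.77812383773681) by lra; subst; lra.
Qed.

(* The eighteen five-term instances were found by linear algebra over the numbers r of the
   cubic field Q(x), of conductor 19, for which r and 1 - r are both S-units, where S is the
   set of primes above 7 and 19. *)
Lemma rogers_saddle (x : R) : 0.77812383773680 < x < 0.77812383773681 ->
  x ^ 3 = 5 * x ^ 2 - 2 * x - 1 ->
  31 * rogers (1 - x) + rogers (- 1645 + 2479 * x - 469 * x ^ 2) = 8 * (PI ^ 2 / 6).
Proof.
intros Hx E3.
(* The equations of the five-term instances have degree at most 4 in x; [E3] and [E4] reduce them to
   identities between 1, x and x^2. *)
assert (E4 : x ^ 4 = 23 * x ^ 2 - 11 * x - 5) by (replace (x ^ 4) with (x * x ^ 3) by ring; rewrite E3; lra).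
assert (Hx2 : 0.77812383773680 ^ 2 < x ^ 2 < 0.77812383773681 ^ 2) by (split; nra).
abbreviate_real u (1 - x).
abbreviate_real v (- 1645 + 2479 * x - 469 * x ^ 2).
abbreviate_real r2 ((3 - 3 * x + x ^ 2) / 7).
abbreviate_real r3 ((- 1 + 6 * x - x ^ 2) / 7).
abbreviate_real r4 ((4 - 5 * x + x ^ 2) / 7).
abbreviate_real r5 ((- 5 + 8 * x - x ^ 2) / 7).
abbreviate_real r6 ((- 8 + 17 * x - 3 * x ^ 2) / 7).
abbreviate_real r7 (- 63 + 95 * x - 18 * x ^ 2).
abbreviate_real r8 (5769 - 8694 * x + 1645 * x ^ 2).
abbreviate_real r9 ((5 - 7 * x + x ^ 2) / 7).
abbreviate_real r10 (- 17 + 26 * x - 5 * x ^ 2).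
abbreviate_real r11 (14 - 21 * x + 4 * x ^ 2).
abbreviate_real r12 (1 - 2 * x + x ^ 2).
abbreviate_real r13 ((31 - 39 * x + 10 * x ^ 2) / 49).
abbreviate_real r14 ((1 + x) / 7).
abbreviate_real r15 ((2 - 3 * x + x ^ 2) / 7).
abbreviate_real r16 ((20 - 11 * x + 4 * x ^ 2) / 49).
abbreviate_real r17 (- 7 + 11 * x - 2 * x ^ 2).
abbreviate_real r18 ((- 10 + 18 * x - 3 * x ^ 2) / 7).
abbreviate_real r19 (- 1 - 2 * x + 5 * x ^ 2).
abbreviate_real r20 (- 104 - 231 * x + 469 * x ^ 2).
abbreviate_real r21 ((10 + 45 * x - 4 * x ^ 2) / 133).
abbreviate_real r22 (2 - x - 2 * x ^ 2).
abbreviate_real r23 ((4 - 4 * x + x ^ 2) / 7).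
abbreviate_real r24 (- 3 + 5 * x - x ^ 2).
abbreviate_real r25 ((- 6 + 13 * x - 2 * x ^ 2) / 7).
abbreviate_real r26 ((- 138 + 208 * x - 39 * x ^ 2) / 7).
abbreviate_real r27 (1 - x ^ 2).
abbreviate_real r28 ((61 - 96 * x + 25 * x ^ 2) / 133).
abbreviate_real r29 ((7 - 6 * x + x ^ 2) / 7).
abbreviate_real r30 (- 20 - 56 * x + 105 * x ^ 2).
rogers_reflect u.
rogers_reflect r2.
rogers_reflect r3.
rogers_reflect r4.
rogers_reflect r6.
rogers_reflect r7.
rogers_reflect r8.
rogers_reflect r9.
rogers_reflect r10.
rogers_reflect r12.
rogers_reflect r13.
rogers_reflect r14.
rogers_reflect r15.
rogers_reflect r16.
rogers_reflect r17.
rogers_reflect r18.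
rogers_reflect r19.
rogers_reflect r20.
rogers_reflect r21.
rogers_reflect r22.
rogers_reflect r24.
rogers_reflect r26.
rogers_reflect r28.
rogers_reflect r29.
rogers_reflect r30.
rogers_five r2 (1 - r3) r4 r5 (1 - r6).
rogers_five r7 r7 r8 r9 r9.
rogers_five (1 - r10) (1 - r9) (1 - u) r11 (1 - r4).
rogers_five (1 - r2) u r2 (1 - u) r12.
rogers_five r13 (1 - r14) r4 r15 (1 - r16).
rogers_five (1 - r17) (1 - r13) (1 - r3) r10 (1 - r18).
rogers_five r19 r19 r20 r21 r21.
rogers_five (1 - r15) (1 - r22) (1 - r12) r23 (1 - u).
rogers_five (1 - r17) r3 r24 (1 - r6) r23.
rogers_five r25 r11 r26 r27 r12.
rogers_five (1 - r7) (1 - r28) (1 - r26) r18 (1 - r21).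
rogers_five (1 - r19) (1 - r14) r27 u (1 - r29).
rogers_five (1 - r30) (1 - u) (1 - r20) (1 - r8) v.
rogers_five (1 - r28) r22 r28 (1 - r22) r30.
rogers_five r24 r24 r11 u u.
rogers_five (1 - r24) (1 - r29) r25 (1 - r6) r16.
rogers_five r17 (1 - r2) r24 r5 (1 - r14).
rogers_five r27 (1 - r3) u u r3.
(* The 25 reflections and 18 five-term relations are linear in the values of [rogers]; the claim is
   a rational combination of them. *)
subst u v; lra.
Qed.

(** * The Euler distribution *)

Lemma qpoch_pos (q : R) (n : nat) : 0 < q < 1 -> 0 < qpoch q q n.
Proof.
intros Hq; induction n as [|n IH]; simpl; [lra|].
apply Rmult_lt_0_compat; [exact IH|].
enough (q * q ^ n < 1) by lra.
rewrite tech_pow_Rmult; apply pow_lt_1_compat; [lra|lia].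
Qed.

Definition bounded_by (M : R) (f : nat -> R) : Prop := forall n, Rabs (f n) <= M.

(** By Euler's identity the weights sum to 1 / (z; q)_infinity; once normalised, they are the law of
    a sum of independent geometric variables with parameters z q^n, n >= 0. *)
Definition wt (q z : R) (f : nat -> R) : R :=
  Series (fun r => z ^ r / qpoch q q r * f r).

Lemma wt_term_pos (q z : R) (r : nat) : 0 < q < 1 -> 0 <= z -> 0 <= z ^ r / qpoch q q r.
Proof.
intros Hq Hz; apply Rdiv_le_0_compat; [now apply pow_le|now apply qpoch_pos].
Qed.

Lemma ex_wt_abs (q z : R) : 0 < q < 1 -> 0 <= z < 1 ->
  ex_series (fun r => z ^ r / qpoch q q r).
Proof.
intros Hq.
assert (H0 : forall t, 0 < t < 1 -> ex_series (fun r => t ^ r / qpoch q q r)).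
{ clear z; intros z Hz.
  assert (Hpos : forall r, 0 < z ^ r / qpoch q q r).
  { intro r; apply Rdiv_lt_0_compat; [apply pow_lt; lra|now apply qpoch_pos]. }
  apply ex_series_ext with (fun r => Rabs (z ^ r / qpoch q q r)).
  { intro n; apply Rabs_pos_eq; left; apply Hpos. }
  apply ex_series_DAlembert with z; [lra| |].
  { intro n; apply Rgt_not_eq, Hpos. }
  apply is_lim_seq_ext with (fun n => z / (1 - q * q ^ n)).
  { intro n.
    assert (H := qpoch_pos q n Hq).
    assert (H' := qpoch_pos q (S n) Hq); simpl in H'.
    assert (0 < 1 - q * q ^ n) by (apply Rmult_lt_reg_l with (qpoch q q n); lra).
    rewrite Rabs_pos_eq.
    - simpl; field; repeat split; try lra; apply pow_nonzero; lra.
    - left; apply Rdiv_lt_0_compat; apply Hpos. }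
  replace (Finite z) with (Finite (z / (1 - q * 0))) by (f_equal; field; lra).
  apply is_lim_seq_div'; [apply is_lim_seq_const| |lra].
  apply is_lim_seq_minus'; [apply is_lim_seq_const|].
  apply (is_lim_seq_scal_l (fun n => q ^ n) q 0).
  apply is_lim_seq_geom; rewrite Rabs_pos_eq; lra. }
(* The ratio test wants nonzero terms; comparison with the positive parameter (z + 1) / 2 also
   covers z = 0. *)
intros Hz.
apply (ex_series_le (K := R_AbsRing) (V := R_CompleteNormedModule) _
  (fun r => ((z + 1) / 2) ^ r / qpoch q q r)); [|apply H0; lra].
intro r; unfold norm; simpl; unfold abs; simpl.
rewrite Rabs_pos_eq by (apply wt_term_pos; lra).
apply Rmult_le_compat_r; [left; apply Rinv_0_lt_compat; now apply qpoch_pos|].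
apply pow_incr; lra.
Qed.

Lemma ex_series_Rscal (c : R) (a : nat -> R) : ex_series a -> ex_series (fun n => c * a n).
Proof. intros [l Hl]; exists (c * l); now apply (is_series_scal_l c a l). Qed.

Lemma ex_wt (q z M : R) (f : nat -> R) : 0 < q < 1 -> 0 <= z < 1 -> bounded_by M f ->
  ex_series (fun r => z ^ r / qpoch q q r * f r).
Proof.
intros Hq Hz Hf.
apply (ex_series_le (K := R_AbsRing) (V := R_CompleteNormedModule) _
  (fun r => M * (z ^ r / qpoch q q r))).
- intro r; unfold norm; simpl; unfold abs; simpl.
  assert (0 <= z ^ r / qpoch q q r).
  { apply Rdiv_le_0_compat; [apply pow_le; lra|now apply qpoch_pos]. }
  rewrite Rabs_mult, (Rabs_pos_eq (_ / _)) by assumption.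
  specialize (Hf r); nra.
- apply ex_series_Rscal, ex_wt_abs; assumption.
Qed.

Lemma wt_plus (q z M N : R) (f g : nat -> R) : 0 < q < 1 -> 0 <= z < 1 ->
  bounded_by M f -> bounded_by N g ->
  wt q z (fun r => f r + g r) = wt q z f + wt q z g.
Proof.
intros Hq Hz Hf Hg; unfold wt.
rewrite <- Series_plus; [|now apply ex_wt with M|now apply ex_wt with N].
apply Series_ext; intro n; ring.
Qed.

Lemma wt_scal (q z c : R) (f : nat -> R) : wt q z (fun r => c * f r) = c * wt q z f.
Proof.
unfold wt; rewrite <- Series_scal_l; apply Series_ext; intro n; ring.
Qed.

Lemma wt_ext (q z : R) (f g : nat -> R) : (forall r, f r = g r) -> wt q z f = wt q z g.
Proof. intro H; apply Series_ext; intro n; now rewrite H. Qed.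

Lemma wt_head (q z M : R) (f : nat -> R) : 0 < q < 1 -> 0 <= z < 1 -> bounded_by M f ->
  wt q z f = f O + Series (fun r => z ^ S r / qpoch q q (S r) * f (S r)).
Proof.
intros Hq Hz Hf; unfold wt.
rewrite Series_incr_1 by now apply ex_wt with M.
simpl (z ^ 0 / _ * _); unfold Rdiv; rewrite Rinv_1; lra.
Qed.

(** Termwise, z^r (1 - q^r) / (q; q)_r = z z^(r-1) / (q; q)_(r-1). In probabilistic terms, the law
    at z is the law at z q convolved with a geometric law of parameter z. *)
Lemma wt_shift (q z M : R) (f : nat -> R) : 0 < q < 1 -> 0 <= z < 1 -> bounded_by M f ->
  wt q z f - wt q (z * q) f = z * wt q z (fun r => f (S r)).
Proof.
intros Hq Hz Hf.
assert (Hzq : 0 <= z * q < 1) by nra.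
rewrite (wt_head q z M), (wt_head q (z * q) M) by assumption.
unfold wt; rewrite <- Series_scal_l.
match goal with |- ?a + ?s - (?a + ?t) = _ => replace (a + s - (a + t)) with (s - t) by ring end.
rewrite <- Series_minus.
- apply Series_ext; intro r.
  assert (H := qpoch_pos q r Hq).
  assert (H' := qpoch_pos q (S r) Hq).
  rewrite Rpow_mult_distr; simpl qpoch in *; simpl pow.
  assert (1 - q * q ^ r <> 0) by (intro E; rewrite E in H'; lra).
  field; repeat split; try assumption; try lra.
- apply (ex_series_incr_1 (fun r => z ^ r / qpoch q q r * f r)); now apply ex_wt with M.
- apply (ex_series_incr_1 (fun r => (z * q) ^ r / qpoch q q r * f r)); now apply ex_wt with M.
Qed.

Definition wt1 (q z : R) : R := wt q z (fun _ => 1).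

Lemma wt_le (q z M : R) (f g : nat -> R) : 0 < q < 1 -> 0 <= z < 1 -> bounded_by M g ->
  (forall r, Rabs (f r) <= g r) -> Rabs (wt q z f) <= wt q z g.
Proof.
intros Hq Hz Hg Hfg; unfold wt.
assert (Hp : forall r, 0 <= z ^ r / qpoch q q r) by (intro r; apply wt_term_pos; lra).
assert (Hle : forall r, Rabs (z ^ r / qpoch q q r * f r) <= z ^ r / qpoch q q r * g r).
{ intro r; rewrite Rabs_mult, Rabs_pos_eq by apply Hp.
  apply Rmult_le_compat_l; [apply Hp|apply Hfg]. }
assert (He : ex_series (fun r => z ^ r / qpoch q q r * g r)) by now apply ex_wt with M.
eapply Rle_trans; [apply Series_Rabs|].
- apply (ex_series_le (K := R_AbsRing) (V := R_CompleteNormedModule) _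
    (fun r => z ^ r / qpoch q q r * g r)); [|exact He].
  intro r; unfold norm; simpl; unfold abs; simpl; rewrite Rabs_Rabsolu; apply Hle.
- apply Series_le; [intro n; split; [apply Rabs_pos|apply Hle]|exact He].
Qed.

Lemma bounded_const (c : R) : bounded_by (Rabs c) (fun _ => c).
Proof. intro n; apply Rle_refl. Qed.

(** Without its constant term the series is z times a power series with nonnegative coefficients, so
    its quotient by z increases. At z = z0 q^n this shows that the normalising sum tends to 1
    geometrically. *)
Lemma wt1_le (q z0 z : R) : 0 < q < 1 -> 0 < z0 < 1 -> 0 <= z <= z0 ->
  0 <= wt1 q z - 1 <= z * ((wt1 q z0 - 1) / z0).
Proof.
intros Hq Hz0 Hz.
assert (B := bounded_const 1).
assert (Hz1 : 0 <= z < 1) by lra.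
assert (Hz01 : 0 <= z0 < 1) by lra.
assert (E0 := ex_wt q z0 _ _ Hq Hz01 B).
unfold wt1; rewrite (wt_head q z _ _ Hq Hz1 B), (wt_head q z0 _ _ Hq Hz01 B).
match goal with |- 0 <= 1 + ?s - 1 <= _ * ((1 + ?t - 1) / _) =>
  replace (1 + s - 1) with s by ring; replace (z * ((1 + t - 1) / z0)) with (z / z0 * t) by (field; lra) end.
rewrite <- Series_scal_l.
assert (Hp : forall r, 0 <= z ^ S r / qpoch q q (S r) * 1 <= z / z0 * (z0 ^ S r / qpoch q q (S r) * 1)).
{ intro r; assert (H := qpoch_pos q (S r) Hq).
  assert (z ^ r <= z0 ^ r) by (apply pow_incr; lra).
  assert (0 <= z ^ r) by (apply pow_le; lra).
  split.
  - rewrite Rmult_1_r; apply Rdiv_le_0_compat; [apply pow_le; lra|assumption].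
  - simpl pow; replace (z / z0 * (z0 * z0 ^ r / qpoch q q (S r) * 1))
      with (z * z0 ^ r / qpoch q q (S r)) by (field; split; lra).
    rewrite Rmult_1_r; apply Rmult_le_compat_r; [left; now apply Rinv_0_lt_compat|].
    apply Rmult_le_compat_l; lra. }
assert (E1 : ex_series (fun r => z / z0 * (z0 ^ S r / qpoch q q (S r) * 1))).
{ apply ex_series_Rscal.
  now apply (ex_series_incr_1 (fun r => z0 ^ r / qpoch q q r * 1)). }
split.
(* The lower bound 0 is written as a series of zeros, for a termwise comparison. *)
- rewrite <- (Rmult_0_l (Series (fun _ => 0))), <- Series_scal_l.
  apply Series_le.
  + intro n; rewrite Rmult_0_l; split; [lra|apply Hp].
  + apply (ex_series_incr_1 (fun r => z ^ r / qpoch q q r * 1)); now apply ex_wt with (Rabs 1).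
- now apply Series_le.
Qed.

Lemma wt1_ge_1 (q z : R) : 0 < q < 1 -> 0 <= z < 1 -> 1 <= wt1 q z.
Proof.
intros Hq Hz; destruct (Req_dec z 0) as [->|Hz0].
- generalize (wt1_le q (1/2) 0 Hq); lra.
- generalize (wt1_le q z z Hq); lra.
Qed.

Lemma wt1_shift (q z : R) : 0 < q < 1 -> 0 <= z < 1 -> wt1 q (z * q) = (1 - z) * wt1 q z.
Proof.
intros Hq Hz; generalize (wt_shift q z _ _ Hq Hz (bounded_const 1)); unfold wt1; simpl; lra.
Qed.

Definition Mean (q z : R) (f : nat -> R) : R := wt q z f / wt1 q z.

Lemma Mean_le (q z M : R) (f : nat -> R) : 0 < q < 1 -> 0 <= z < 1 -> bounded_by M f ->
  Rabs (Mean q z f) <= M.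
Proof.
intros Hq Hz Hf; unfold Mean.
assert (H := wt1_ge_1 q z Hq Hz).
unfold Rdiv; rewrite Rabs_mult, (Rabs_pos_eq (/ _)) by (left; apply Rinv_0_lt_compat; lra).
apply Rmult_le_reg_r with (wt1 q z); [lra|].
rewrite Rmult_assoc, Rinv_l, Rmult_1_r by lra.
unfold wt1; rewrite <- wt_scal.
apply wt_le with (Rabs (M * 1)); [assumption..|apply bounded_const|].
intro r; rewrite Rmult_1_r; apply Hf.
Qed.

Lemma bounded_minus (M N : R) (f g : nat -> R) : bounded_by M f -> bounded_by N g ->
  bounded_by (M + N) (fun r => f r - g r).
Proof.
intros Hf Hg r; specialize (Hf r); specialize (Hg r).
apply Rabs_le_between in Hf; apply Rabs_le_between in Hg; apply Rabs_le; lra.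
Qed.

Lemma bounded_scal (c M : R) (f : nat -> R) : bounded_by M f ->
  bounded_by (Rabs c * M) (fun r => c * f r).
Proof.
intros Hf r; rewrite Rabs_mult; apply Rmult_le_compat_l; [apply Rabs_pos|apply Hf].
Qed.

Lemma Mean_minus (q z M N : R) (f g : nat -> R) : 0 < q < 1 -> 0 <= z < 1 ->
  bounded_by M f -> bounded_by N g ->
  Mean q z (fun r => f r - g r) = Mean q z f - Mean q z g.
Proof.
intros Hq Hz Hf Hg; unfold Mean.
rewrite (wt_ext q z _ (fun r => f r + (-1) * g r)) by (intro; ring).
rewrite (wt_plus q z M (Rabs (-1) * N)) by (try assumption; now apply bounded_scal).
rewrite wt_scal; field; generalize (wt1_ge_1 q z Hq Hz); lra.
Qed.

Lemma Mean_ext (q z : R) (f g : nat -> R) : (forall r, f r = g r) -> Mean q z f = Mean q z g.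
Proof. intro H; unfold Mean; now rewrite (wt_ext q z f g). Qed.

Lemma Mean_scal (q z c : R) (f : nat -> R) : Mean q z (fun r => c * f r) = c * Mean q z f.
Proof. unfold Mean; rewrite wt_scal; unfold Rdiv; ring. Qed.

Lemma Mean_dist (q z M N e : R) (f g : nat -> R) : 0 < q < 1 -> 0 <= z < 1 ->
  bounded_by M f -> bounded_by N g -> (forall r, Rabs (f r - g r) <= e) ->
  Rabs (Mean q z f - Mean q z g) <= e.
Proof.
intros Hq Hz Hf Hg H; rewrite <- (Mean_minus q z M N) by assumption; now apply Mean_le.
Qed.

(* The recurrence for [wt] rewrites the expectation at [z * q] as one at [z],
   so that the two can be compared pointwise. *)
Lemma Mean_step (q z M N e : R) (f g : nat -> R) : 0 < q < 1 -> 0 <= z < 1 ->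
  bounded_by M f -> bounded_by N g ->
  (forall r, Rabs (f r - g r + z / (1 - z) * (g (S r) - g r)) <= e) ->
  Rabs (Mean q z f - Mean q (z * q) g) <= e.
Proof.
intros Hq Hz Hf Hg H.
assert (H1 := wt1_ge_1 q z Hq Hz).
assert (Hg' : bounded_by N (fun r => g (S r))) by (intro r; apply Hg).
assert (E : Mean q (z * q) g = Mean q z (fun r => / (1 - z) * g r - z / (1 - z) * g (S r))).
{ rewrite (Mean_minus q z _ _ _ _ Hq Hz (bounded_scal (/ (1 - z)) _ _ Hg)
     (bounded_scal (z / (1 - z)) _ _ Hg')).
  rewrite !Mean_scal; unfold Mean; rewrite wt1_shift by assumption.
  replace (wt q (z * q) g) with (wt q z g - z * wt q z (fun r => g (S r)))
    by (rewrite <- (wt_shift q z N g) by assumption; ring).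
  field; lra. }
rewrite E; eapply (Mean_dist q z); [assumption|assumption|exact Hf| |].
- apply bounded_minus; [apply bounded_scal, Hg|].
  apply (bounded_scal (z / (1 - z)) _ _ Hg').
- intro r; eapply Rle_trans; [|apply (H r)]; right; f_equal; field; lra.
Qed.

(** The mass outside r = 0 is 1 - 1 / [wt1 q z], at most [wt1 q z - 1]; [g] below is the indicator
    of r >= 1. This identifies the limit of the expectations at z q^n. *)
Lemma Mean_head (q z M : R) (f : nat -> R) : 0 < q < 1 -> 0 <= z < 1 -> bounded_by M f ->
  Rabs (Mean q z f - f O) <= 2 * M * (wt1 q z - 1).
Proof.
intros Hq Hz Hf.
assert (H1 := wt1_ge_1 q z Hq Hz).
assert (HM : 0 <= M) by (eapply Rle_trans; [apply Rabs_pos|apply (Hf O)]).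
pose (g := fun r : nat => match r with O => 0 | S _ => 1 end).
assert (Bg : bounded_by (Rabs 1) g).
{ intros [|r]; simpl; [rewrite Rabs_R0; apply Rabs_pos|lra]. }
assert (Eg : wt q z g = wt1 q z - 1).
{ unfold wt1; rewrite (wt_head q z _ g Hq Hz Bg), (wt_head q z _ _ Hq Hz (bounded_const 1)).
  simpl g; ring. }
assert (B0 : bounded_by (Rabs (f O)) (fun _ => f O)) by apply bounded_const.
assert (E : Mean q z f - f O = wt q z (fun r => f r - f O) / wt1 q z).
{ change (Mean q z f - f O = Mean q z (fun r => f r - f O)).
  rewrite (Mean_minus q z M _ _ _ Hq Hz Hf B0); f_equal.
  rewrite (Mean_ext q z (fun _ => f O) (fun r => f O * 1)) by (intro; ring).
  rewrite Mean_scal; unfold Mean; fold (wt1 q z); field; lra. }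
rewrite E, <- Eg; unfold Rdiv.
rewrite Rabs_mult, (Rabs_pos_eq (/ _)) by (left; apply Rinv_0_lt_compat; lra).
assert (H : Rabs (wt q z (fun r => f r - f O)) <= 2 * M * wt q z g).
{ rewrite <- wt_scal.
  apply wt_le with (Rabs (2 * M) * Rabs 1); [assumption..|now apply bounded_scal|].
  intros [|r]; simpl.
  - rewrite Rminus_diag, Rabs_R0; lra.
  - assert (Ha := Hf O); assert (Hb := Hf (S r)).
    apply Rabs_le_between in Ha; apply Rabs_le_between in Hb; apply Rabs_le; lra. }
rewrite <- (Rmult_1_r (2 * M * wt q z g)).
apply Rmult_le_compat; [apply Rabs_pos|left; apply Rinv_0_lt_compat; lra|exact H|].
rewrite <- Rinv_1; apply Rinv_le_contravar; lra.
Qed.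

(** * Taylor estimates for Li2 and its derivatives along z exp (- s) *)

Lemma taylor_order_1 (f f1 f2 : R -> R) (a b M : R) :
  (forall x, Rmin a b <= x <= Rmax a b -> is_derive f x (f1 x)) ->
  (forall x, Rmin a b <= x <= Rmax a b -> is_derive f1 x (f2 x)) ->
  (forall x, Rmin a b <= x <= Rmax a b -> Rabs (f2 x) <= M) ->
  Rabs (f b - f a - (b - a) * f1 a) <= M * Rabs (b - a) ^ 2.
Proof.
intros H1 H2 HM.
assert (Hab : Rmin a b <= a <= Rmax a b) by (split; [apply Rmin_l|apply Rmax_l]).
assert (Hbb : Rmin a b <= b <= Rmax a b) by (split; [apply Rmin_r|apply Rmax_r]).
assert (H : forall x, Rmin a b <= x <= Rmax a b -> Rabs (f1 x - f1 a) <= M * Rabs (b - a)).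
{ intros x Hx.
  assert (Hs : forall y, Rmin a x <= y <= Rmax a x -> Rmin a b <= y <= Rmax a b).
  { intros y Hy; split.
    - apply Rle_trans with (2 := proj1 Hy); apply Rmin_glb; lra.
    - apply Rle_trans with (1 := proj2 Hy); apply Rmax_lub; lra. }
  apply Rle_trans with (M * Rabs (x - a)).
  - apply (mean_value_ineq f1 f2); intros y Hy; [apply H2|apply HM]; now apply Hs.
  - apply Rmult_le_compat_l; [eapply Rle_trans; [apply Rabs_pos|apply (HM a Hab)]|].
    revert Hx; unfold Rmin, Rmax; destruct (Rle_dec a b); intro Hx;
      unfold Rabs; destruct (Rcase_abs (x - a)), (Rcase_abs (b - a)); lra. }
replace (f b - f a - (b - a) * f1 a)
  with ((f b - (b - a) * f1 a) - (f a - (a - a) * f1 a)) by ring.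
replace (M * Rabs (b - a) ^ 2) with (M * Rabs (b - a) * Rabs (b - a)) by ring.
apply (mean_value_ineq (fun x => f x - (x - a) * f1 a) (fun x => f1 x - f1 a)); [|exact H].
intros x Hx; apply (is_derive_minus f (fun x => (x - a) * f1 a) x (f1 x) (f1 a)); [now apply H1|].
auto_derive; [trivial|ring].
Qed.

Lemma taylor_order_2 (f f1 f2 f3 : R -> R) (a b M : R) :
  (forall x, Rmin a b <= x <= Rmax a b -> is_derive f x (f1 x)) ->
  (forall x, Rmin a b <= x <= Rmax a b -> is_derive f1 x (f2 x)) ->
  (forall x, Rmin a b <= x <= Rmax a b -> is_derive f2 x (f3 x)) ->
  (forall x, Rmin a b <= x <= Rmax a b -> Rabs (f3 x) <= M) ->
  Rabs (f b - f a - (b - a) * f1 a - (b - a) ^ 2 / 2 * f2 a) <= M * Rabs (b - a) ^ 3.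
Proof.
intros H1 H2 H3 HM.
assert (Hab : Rmin a b <= a <= Rmax a b) by (split; [apply Rmin_l|apply Rmax_l]).
assert (Hbb : Rmin a b <= b <= Rmax a b) by (split; [apply Rmin_r|apply Rmax_r]).
assert (M0 : 0 <= M) by (eapply Rle_trans; [apply Rabs_pos|apply (HM a Hab)]).
assert (H : forall x, Rmin a b <= x <= Rmax a b ->
  Rabs (f1 x - f1 a - (x - a) * f2 a) <= M * Rabs (b - a) ^ 2).
{ intros x Hx.
  assert (Hs : forall y, Rmin a x <= y <= Rmax a x -> Rmin a b <= y <= Rmax a b).
  { intros y Hy; split.
    - apply Rle_trans with (2 := proj1 Hy); apply Rmin_glb; lra.
    - apply Rle_trans with (1 := proj2 Hy); apply Rmax_lub; lra. }
  apply Rle_trans with (M * Rabs (x - a) ^ 2).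
  - apply (taylor_order_1 f1 f2 f3); intros y Hy; [apply H2|apply H3|apply HM]; now apply Hs.
  - apply Rmult_le_compat_l; [exact M0|]; apply pow_incr; split; [apply Rabs_pos|].
    revert Hx; unfold Rmin, Rmax; destruct (Rle_dec a b); intro Hx;
      unfold Rabs; destruct (Rcase_abs (x - a)), (Rcase_abs (b - a)); lra. }
replace (f b - f a - (b - a) * f1 a - (b - a) ^ 2 / 2 * f2 a)
  with ((f b - (b - a) * f1 a - (b - a) ^ 2 / 2 * f2 a)
      - (f a - (a - a) * f1 a - (a - a) ^ 2 / 2 * f2 a)) by field.
replace (M * Rabs (b - a) ^ 3) with (M * Rabs (b - a) ^ 2 * Rabs (b - a)) by ring.
apply (mean_value_ineq (fun x => f x - (x - a) * f1 a - (x - a) ^ 2 / 2 * f2 a)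
  (fun x => f1 x - f1 a - (x - a) * f2 a)); [|exact H].
intros x Hx.
apply (is_derive_minus (fun x => f x - (x - a) * f1 a) (fun x => (x - a) ^ 2 / 2 * f2 a) x
  (f1 x - f1 a) ((x - a) * f2 a)).
- apply (is_derive_minus f (fun x => (x - a) * f1 a) x (f1 x) (f1 a)); [now apply H1|].
  auto_derive; [trivial|ring].
- auto_derive; [trivial|field].
Qed.

(** At parameter z exp (- s), the Euler law in base exp (- e) has mean close to [lam z s / e] and
    variance close to [odds z s / e]: a geometric variable has mean [odds] and variance
    [odds + odds^2], and the sums over its parameters are Riemann sums of - lam' and - odds'. *)
Definition lam (z s : R) : R := - ln (1 - z * exp (- s)).
Definition odds (z s : R) : R := z * exp (- s) / (1 - z * exp (- s)).

Lemma exp_le_compat (x y : R) : x <= y -> exp x <= exp y.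
Proof. intros [H| ->]; [left; now apply exp_increasing|apply Rle_refl]. Qed.

Lemma arg_bound (z s : R) : 0 < z < 1 -> 0 <= s -> 0 < z * exp (- s) <= z.
Proof.
intros Hz Hs; assert (H := exp_pos (- s)).
assert (exp (- s) <= 1) by (rewrite <- exp_0; apply exp_le_compat; lra); nra.
Qed.

Lemma is_derive_lam (z s : R) : 0 < z < 1 -> 0 <= s -> is_derive (lam z) s (- odds z s).
Proof.
intros Hz Hs; assert (H := arg_bound z s Hz Hs); unfold lam, odds.
auto_derive; [lra|field; lra].
Qed.

Lemma is_derive_odds (z s : R) : 0 < z < 1 -> 0 <= s ->
  is_derive (odds z) s (- (odds z s + odds z s ^ 2)).
Proof.
intros Hz Hs; assert (H := arg_bound z s Hz Hs); unfold odds.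
auto_derive; [lra|field; lra].
Qed.

Lemma is_derive_Li2_exp (z s : R) : 0 < z < 1 -> 0 <= s ->
  is_derive (fun s => Li2 (z * exp (- s))) s (- lam z s).
Proof.
intros Hz Hs; assert (H := arg_bound z s Hz Hs); unfold lam.
auto_derive; [apply ex_derive_Li2; lra|].
rewrite Derive_Li2 by lra; field; split; [apply Rgt_not_eq, exp_pos|lra].
Qed.

Lemma odds_bound (z s s' : R) : 0 < z < 1 -> 0 <= s <= s' -> 0 < odds z s' <= odds z s.
Proof.
intros Hz Hs; assert (H := arg_bound z s Hz ltac:(lra)).
assert (H' := arg_bound z s' Hz ltac:(lra)).
assert (He : exp (- s') <= exp (- s)) by (apply exp_le_compat; lra).
unfold odds; split; [apply Rdiv_lt_0_compat; lra|].
apply Rmult_le_compat; [lra|left; apply Rinv_0_lt_compat; lra|nra|].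
apply Rinv_le_contravar; nra.
Qed.

Lemma odds_0 (z : R) : odds z 0 = z / (1 - z).
Proof. unfold odds; now rewrite Ropp_0, exp_0, Rmult_1_r. Qed.

Lemma lam_0 (z : R) : lam z 0 = - ln (1 - z).
Proof. unfold lam; now rewrite Ropp_0, exp_0, Rmult_1_r. Qed.

Lemma odds_le_geom (z s : R) : 0 < z < 1 -> 0 <= s -> odds z s <= z / (1 - z) * exp (- s).
Proof.
intros Hz Hs; assert (H := arg_bound z s Hz Hs); unfold odds.
replace (z / (1 - z) * exp (- s)) with (z * exp (- s) * / (1 - z)) by (field; lra).
apply Rmult_le_compat_l; [lra|]; apply Rinv_le_contravar; lra.
Qed.

Lemma lam_bound (z s : R) : 0 < z < 1 -> 0 <= s -> 0 <= lam z s <= odds z s.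
Proof.
intros Hz Hs; assert (H := arg_bound z s Hz Hs).
unfold lam, odds; apply neg_ln_1_minus; lra.
Qed.

Section Increments.
Variables (z s e : R).
Hypotheses (Hz : 0 < z < 1) (Hs : 0 <= s) (He : 0 < e).
Let t0 := z / (1 - z).

Lemma odds_le_t0 (r : R) : 0 <= r -> odds z r <= t0.
Proof. intro Hr; unfold t0; rewrite <- odds_0; apply odds_bound; lra. Qed.

Lemma interval_shift (r : R) : Rmin s (s + e) <= r <= Rmax s (s + e) -> s <= r.
Proof. rewrite Rmin_left, Rmax_right by lra; lra. Qed.

Lemma odds_sqr_bound (r : R) : s <= r ->
  Rabs (odds z r + odds z r ^ 2) <= (1 + t0) * odds z s.
Proof.
intro Hr; assert (H := odds_bound z s r Hz ltac:(lra)).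
assert (H0 := odds_le_t0 s Hs); rewrite Rabs_pos_eq by nra; nra.
Qed.

(** Here and in the next two lemmas the remainder is kept proportional to [odds z s], so that by
    [odds_le_geom] it decays like q^n at s = n e. *)
Lemma lam_increment :
  Rabs (lam z (s + e) - lam z s + e * odds z s) <= (1 + t0) * odds z s * e ^ 2.
Proof.
assert (H := taylor_order_1 (lam z) (fun r => - odds z r) (fun r => odds z r + odds z r ^ 2)
  s (s + e) ((1 + t0) * odds z s)).
replace (s + e - s) with e in H by ring; rewrite (Rabs_pos_eq e) in H by lra.
replace (lam z (s + e) - lam z s + e * odds z s)
  with (lam z (s + e) - lam z s - e * - odds z s) by ring.
apply H; intros r Hr; apply interval_shift in Hr.
- apply is_derive_lam; lra.
- replace (odds z r + odds z r ^ 2) with (- - (odds z r + odds z r ^ 2)) by ring.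
  apply (is_derive_opp (odds z)), is_derive_odds; lra.
- now apply odds_sqr_bound.
Qed.

Lemma odds_increment :
  Rabs (odds z (s + e) - odds z s + e * (odds z s + odds z s ^ 2))
    <= (1 + 2 * t0) * (1 + t0) * odds z s * e ^ 2.
Proof.
assert (H := taylor_order_1 (odds z) (fun r => - (odds z r + odds z r ^ 2))
  (fun r => (1 + 2 * odds z r) * (odds z r + odds z r ^ 2))
  s (s + e) ((1 + 2 * t0) * ((1 + t0) * odds z s))).
replace (s + e - s) with e in H by ring; rewrite (Rabs_pos_eq e) in H by lra.
replace (odds z (s + e) - odds z s + e * (odds z s + odds z s ^ 2))
  with (odds z (s + e) - odds z s - e * - (odds z s + odds z s ^ 2)) by ring.
rewrite <- Rmult_assoc in H.
apply H; intros r Hr; apply interval_shift in Hr.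
- apply is_derive_odds; lra.
- assert (D := is_derive_odds z r Hz ltac:(lra)).
  assert (E : Derive (fun x : R => odds z x) r = - (odds z r + odds z r ^ 2))
    by now apply is_derive_unique.
  auto_derive; [repeat split; now exists (- (odds z r + odds z r ^ 2))|].
  rewrite E; ring.
- assert (H1 := odds_bound z s r Hz ltac:(lra)); assert (H0 := odds_le_t0 s Hs).
  rewrite Rabs_mult, (Rmult_assoc (1 + 2 * t0)); apply Rmult_le_compat; try apply Rabs_pos.
  + rewrite Rabs_pos_eq; lra.
  + now apply odds_sqr_bound.
Qed.

Lemma Li2_increment :
  Rabs (Li2 (z * exp (- (s + e))) - Li2 (z * exp (- s)) + e * lam z s - e ^ 2 / 2 * odds z s)
    <= (1 + t0) * odds z s * e ^ 3.
Proof.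
assert (H := taylor_order_2 (fun r => Li2 (z * exp (- r))) (fun r => - lam z r) (odds z)
  (fun r => - (odds z r + odds z r ^ 2)) s (s + e) ((1 + t0) * odds z s)).
replace (s + e - s) with e in H by ring; rewrite (Rabs_pos_eq e) in H by lra.
replace (_ - _ + _ - _) with (Li2 (z * exp (- (s + e))) - Li2 (z * exp (- s)) - e * - lam z s
  - e ^ 2 / 2 * odds z s) by ring.
apply H; intros r Hr; apply interval_shift in Hr.
- apply is_derive_Li2_exp; lra.
- rewrite <- (Ropp_involutive (odds z r)).
  apply (is_derive_opp (lam z)), is_derive_lam; lra.
- apply is_derive_odds; lra.
- rewrite Rabs_Ropp; now apply odds_sqr_bound.
Qed.

End Increments.

(** Step errors B q^n add up to B / (1 - q), which for q = exp (- e) is at most 2 B / e by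
    [exp_neg_bounds]. *)
Lemma telescoping_geom (a : nat -> R) (l B q : R) : 0 < q < 1 -> 0 <= B ->
  (forall n, Rabs (a n - a (S n)) <= B * q ^ n) -> is_lim_seq a l ->
  Rabs (a O - l) <= B / (1 - q).
Proof.
intros Hq HB H Hl.
assert (Hn : forall n, Rabs (a O - a n) <= B * (1 - q ^ n) / (1 - q)).
{ induction n as [|n IH].
  - rewrite Rminus_diag, Rabs_R0; simpl; right; field; lra.
  - replace (a O - a (S n)) with ((a O - a n) + (a n - a (S n))) by ring.
    eapply Rle_trans; [apply Rabs_triang|].
    eapply Rle_trans; [apply Rplus_le_compat; [exact IH|apply H]|].
    right; simpl; field; lra. }
assert (L : is_lim_seq (fun n => Rabs (a O - a n)) (Rabs (a O - l))).
{ apply (is_lim_seq_abs _ (a O - l)), is_lim_seq_minus'; [apply is_lim_seq_const|exact Hl]. }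
apply (is_lim_seq_le (fun n => Rabs (a O - a n)) (fun _ => B / (1 - q)) (Rabs (a O - l)) (B / (1 - q)));
  [|exact L|apply is_lim_seq_const].
intro n; eapply Rle_trans; [apply Hn|].
apply Rmult_le_compat_r; [left; apply Rinv_0_lt_compat; lra|].
assert (0 <= q ^ n) by (apply pow_le; lra); nra.
Qed.

Lemma exp_neg_bounds (e : R) : 0 < e <= 1 -> 0 < exp (- e) < 1 /\ / (1 - exp (- e)) <= 2 / e.
Proof.
intros He.
assert (H := exp_ineq1_le e); assert (H1 := exp_pos e).
assert (E : exp (- e) <= / (1 + e)).
{ rewrite exp_Ropp; apply Rinv_le_contravar; lra. }
assert (H2 : / (1 + e) <= 1 - e / 2).
{ apply Rmult_le_reg_r with (1 + e); [lra|]; rewrite Rinv_l by lra; nra. }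
split; [split; [apply exp_pos|lra]|].
replace (2 / e) with (/ (e / 2)) by (field; lra).
apply Rinv_le_contravar; lra.
Qed.

Lemma exp_pow_neg (e : R) (n : nat) : exp (- e) ^ n = exp (- (INR n * e)).
Proof.
induction n as [|n IH]; [simpl; now rewrite Rmult_0_l, Ropp_0, exp_0|].
rewrite S_INR, <- tech_pow_Rmult, IH, <- exp_plus; f_equal; ring.
Qed.

Lemma lim_geom (q : R) : 0 < q < 1 -> is_lim_seq (fun n => q ^ n) 0.
Proof. intro Hq; apply is_lim_seq_geom; rewrite Rabs_pos_eq; lra. Qed.

Lemma lim_wt1 (q z : R) : 0 < q < 1 -> 0 < z < 1 -> is_lim_seq (fun n => wt1 q (z * q ^ n)) 1.
Proof.
intros Hq Hz.
assert (Hqn : forall n, 0 < q ^ n <= 1).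
{ intro n; split; [apply pow_lt; lra|]; rewrite <- (pow1 n); apply pow_incr; lra. }
apply is_lim_seq_le_le with (fun _ => 1) (fun n => 1 + (wt1 q z - 1) * q ^ n).
- intro n; specialize (Hqn n).
  assert (H := wt1_le q z (z * q ^ n) Hq Hz ltac:(nra)).
  replace (z * q ^ n * ((wt1 q z - 1) / z)) with ((wt1 q z - 1) * q ^ n) in H by (field; lra).
  lra.
- apply is_lim_seq_const.
- replace (Finite 1) with (Finite (1 + (wt1 q z - 1) * 0)) by (f_equal; ring).
  apply is_lim_seq_plus'; [apply is_lim_seq_const|].
  apply (is_lim_seq_scal_l _ _ 0), lim_geom, Hq.
Qed.

Lemma ln_wt1_asymptotic (z : R) : 0 < z < 1 -> exists K, forall e, 0 < e <= 1 ->
  Rabs (ln (wt1 (exp (- e)) z) - (Li2 z / e - ln (1 - z) / 2)) <= K * e.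
Proof.
intros Hz; pose (t0 := z / (1 - z)).
assert (Ht0 : 0 < t0) by (apply Rdiv_lt_0_compat; lra).
exists (4 * (1 + t0) * t0); intros e He.
destruct (exp_neg_bounds e He) as [Hq Hi].
set (q := exp (- e)) in *.
(* The error of the claimed approximation at parameter z q^n; it tends to 0 as n grows, since [wt1]
   tends to 1 and [Li2] to 0. *)
pose (a := fun n => ln (wt1 q (z * q ^ n)) - Li2 (z * q ^ n) / e + ln (1 - z * q ^ n) / 2).
assert (Hqn : forall n, 0 < z * q ^ n < 1).
{ intro n; unfold q; rewrite exp_pow_neg.
  assert (0 <= INR n * e) by (apply Rmult_le_pos; [apply pos_INR|lra]).
  generalize (arg_bound z (INR n * e) Hz); lra. }
assert (H : Rabs (a O - 0) <= 2 * (1 + t0) * t0 * e ^ 2 / (1 - q)).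
{ apply telescoping_geom with (1 := Hq).
  - assert (0 < e ^ 2) by (apply pow_lt; lra); nra.
  - intro n; pose (s := INR n * e).
    assert (Hs : 0 <= s) by (apply Rmult_le_pos; [apply pos_INR|lra]).
    assert (E1 : q ^ n = exp (- s)) by apply exp_pow_neg.
    assert (E2 : q ^ S n = exp (- (s + e))).
    { unfold q; rewrite exp_pow_neg, S_INR; unfold s; do 2 f_equal; ring. }
    assert (W : ln (wt1 q (z * q ^ S n)) = ln (1 - z * q ^ n) + ln (wt1 q (z * q ^ n))).
    { specialize (Hqn n); rewrite <- tech_pow_Rmult.
      replace (z * (q * q ^ n)) with (z * q ^ n * q) by ring.
      assert (1 <= wt1 q (z * q ^ n)) by (apply wt1_ge_1; lra).
      rewrite wt1_shift, ln_mult by lra; reflexivity. }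
    assert (I1 := Li2_increment z s e Hz Hs (proj1 He)).
    assert (I2 := lam_increment z s e Hz Hs (proj1 He)).
    assert (I3 := odds_le_geom z s Hz Hs).
    assert (I4 := odds_bound z s s Hz ltac:(lra)).
    fold t0 in I1, I2, I3; rewrite <- E1 in I3.
    unfold a; rewrite W, E1, E2.
    change (- ln (1 - z * exp (- s))) with (lam z s) in *.
    set (A := Li2 (z * exp (- (s + e))) - Li2 (z * exp (- s)) + e * lam z s - e ^ 2 / 2 * odds z s) in *.
    set (B := lam z (s + e) - lam z s + e * odds z s) in *.
    (* The recurrence contributes [lam z s], which cancels the first-order term of Li2; the
       second-order term e odds / 2 is cancelled by the half-logarithm. Only the Taylor remainders
       survive. *)
    match goal with |- Rabs ?x <= _ => replace x with (A / e + B / 2) end.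
    2:{ unfold A, B, lam; field; lra. }
    eapply Rle_trans; [apply Rabs_triang|].
    unfold Rdiv; rewrite !Rabs_mult, (Rabs_pos_eq (/ e)), (Rabs_pos_eq (/ 2))
      by (left; apply Rinv_0_lt_compat; lra).
    apply Rle_trans with ((1 + t0) * odds z s * e ^ 3 * / e + (1 + t0) * odds z s * e ^ 2 * / 2).
    + apply Rplus_le_compat; apply Rmult_le_compat_r; try assumption; left; apply Rinv_0_lt_compat; lra.
    + replace ((1 + t0) * odds z s * e ^ 3 * / e) with ((1 + t0) * odds z s * e ^ 2) by (field; lra).
      assert (P : 0 <= (1 + t0) * e ^ 2) by (apply Rmult_le_pos; [lra|apply pow2_ge_0]).
      rewrite <- E1.
      apply (Rmult_le_compat_l _ _ _ P) in I3.
      assert (0 <= (1 + t0) * e ^ 2 * odds z s) by (apply Rmult_le_pos; lra).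
      nra.
  - replace (Finite 0) with (Finite (ln 1 - 0 * / e + ln (1 - z * 0) * / 2))
      by (rewrite Rmult_0_r, Rminus_0_r, ln_1; f_equal; ring).
    assert (LZ : is_lim_seq (fun n => z * q ^ n) (z * 0)).
    { apply (is_lim_seq_scal_l _ _ 0), lim_geom, Hq. }
    apply is_lim_seq_plus'; [apply is_lim_seq_minus'|].
    + apply (is_lim_seq_continuous ln (fun n => wt1 q (z * q ^ n)) 1); [|now apply lim_wt1].
      apply continuity_pt_filterlim, continuous_ln; lra.
    + apply (is_lim_seq_scal_r _ (/ e) 0).
      rewrite <- Li2_0, <- (Rmult_0_r z).
      apply (is_lim_seq_continuous Li2); [|exact LZ].
      apply continuity_pt_filterlim, continuous_Li2; lra.
    + apply (is_lim_seq_scal_r _ (/ 2) (ln (1 - z * 0))).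
      apply (is_lim_seq_continuous ln (fun n => 1 - z * q ^ n)).
      * apply continuity_pt_filterlim, continuous_ln; lra.
      * apply is_lim_seq_minus'; [apply is_lim_seq_const|exact LZ]. }
unfold a in H; simpl pow in H; rewrite Rmult_1_r, Rminus_0_r in H.
replace (ln (wt1 q z) - (Li2 z / e - ln (1 - z) / 2))
  with (ln (wt1 q z) - Li2 z / e + ln (1 - z) / 2) by ring.
eapply Rle_trans; [exact H|]; unfold Rdiv.
apply Rle_trans with (2 * (1 + t0) * t0 * e ^ 2 * (2 / e)).
- apply Rmult_le_compat_l; [|exact Hi].
  assert (0 < e ^ 2) by (apply pow_lt; lra); nra.
- right; field; lra.
Qed.

(** * Central limit theorem *)

Lemma Rinv_le_1 (x : R) : 1 <= x -> / x <= 1.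
Proof. intro H; apply Rle_trans with (/ 1); [apply Rinv_le_contravar; lra|rewrite Rinv_1; lra]. Qed.

(* Heat evolution of [exp (- al u^2)]: [d/dt heat = 1/2 d^2/du^2 heat]. *)
Definition heat (al t u : R) : R :=
  exp (- (al / (1 + 2 * al * t)) * u ^ 2) / sqrt (1 + 2 * al * t).
Definition heat1 (al t u : R) : R :=
  let b := al / (1 + 2 * al * t) in - 2 * b * u * heat al t u.
Definition heat2 (al t u : R) : R :=
  let b := al / (1 + 2 * al * t) in (4 * b ^ 2 * u ^ 2 - 2 * b) * heat al t u.
Definition heat3 (al t u : R) : R :=
  let b := al / (1 + 2 * al * t) in (12 * b ^ 2 * u - 8 * b ^ 3 * u ^ 3) * heat al t u.
Definition heat4 (al t u : R) : R :=
  let b := al / (1 + 2 * al * t) in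
  (12 * b ^ 2 - 48 * b ^ 3 * u ^ 2 + 16 * b ^ 4 * u ^ 4) * heat al t u.

Section Heat.
Variable al : R.
Hypothesis Hal : 0 < al.

Lemma heat_den_pos (t : R) : 0 <= t -> 1 <= 1 + 2 * al * t.
Proof. intro Ht; assert (0 <= al * t) by (apply Rmult_le_pos; lra); lra. Qed.

Lemma is_derive_heat_u (t u : R) : is_derive (heat al t) u (heat1 al t u).
Proof. unfold heat1, heat; cbv zeta; auto_derive; [trivial|unfold Rdiv; simpl; ring]. Qed.

Lemma is_derive_heat1_u (t u : R) : is_derive (heat1 al t) u (heat2 al t u).
Proof. unfold heat2, heat1, heat; cbv zeta; auto_derive; [trivial|unfold Rdiv; simpl; ring]. Qed.

Lemma is_derive_heat2_u (t u : R) : is_derive (heat2 al t) u (heat3 al t u).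
Proof. unfold heat3, heat2, heat; cbv zeta; auto_derive; [trivial|unfold Rdiv; simpl; ring]. Qed.

Lemma is_derive_heat_t (t u : R) : 0 <= t ->
  is_derive (fun t => heat al t u) t (heat2 al t u / 2).
Proof.
intro Ht; assert (H := heat_den_pos t Ht); unfold heat2, heat; cbv zeta.
assert (Hs : 0 < sqrt (1 + 2 * al * t)) by (apply sqrt_lt_R0; lra).
auto_derive; [repeat split; lra|].
replace (al * / (1 + 2 * al * t)) with (al / (1 + 2 * al * t)) by reflexivity.
set (E := exp _).
assert (Q : (1 + 2 * al * t) = sqrt (1 + 2 * al * t) ^ 2) by (rewrite pow2_sqrt; lra).
set (s := sqrt (1 + 2 * al * t)) in *.
rewrite Q; field; lra.
Qed.

Lemma is_derive_heat2_t (t u : R) : 0 <= t ->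
  is_derive (fun t => heat2 al t u) t (heat4 al t u / 2).
Proof.
intro Ht; assert (H := heat_den_pos t Ht); unfold heat4, heat2, heat; cbv zeta.
assert (Hs : 0 < sqrt (1 + 2 * al * t)) by (apply sqrt_lt_R0; lra).
auto_derive; [repeat split; lra|].
replace (al * / (1 + 2 * al * t)) with (al / (1 + 2 * al * t)) by reflexivity.
set (E := exp _).
assert (Q : (1 + 2 * al * t) = sqrt (1 + 2 * al * t) ^ 2) by (rewrite pow2_sqrt; lra).
set (s := sqrt (1 + 2 * al * t)) in *.
rewrite Q; field; lra.
Qed.

Lemma exp_poly_bound (w : R) : 0 <= w -> (1 + w) ^ 2 * exp (- w) <= 4.
Proof.
intro Hw; assert (H := exp_ineq1_le (w / 2)).
assert (E : exp (w / 2) ^ 2 * exp (- w) = 1).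
{ simpl; rewrite Rmult_1_r, <- !exp_plus, <- exp_0; f_equal; field. }
assert (P := exp_pos (- w)).
assert ((1 + w) ^ 2 <= 4 * exp (w / 2) ^ 2).
{ replace (4 * exp (w / 2) ^ 2) with ((2 * exp (w / 2)) ^ 2) by ring; apply pow_incr; lra. }
apply Rle_trans with (4 * exp (w / 2) ^ 2 * exp (- w)); [apply Rmult_le_compat_r; lra|lra].
Qed.

(** 160 = 40 * 4: the polynomial prefactors of [heat1] to [heat4] are at most 40 (1 + al)^2 (1 +
    w)^2 with w = b u^2, and (1 + w)^2 exp (- w) <= 4. The bound is uniform in t and u. *)
Definition heat_const : R := 160 * (1 + al) ^ 2.

Lemma heat_bound (t u p : R) : 0 <= t ->
  (let b := al / (1 + 2 * al * t) in Rabs p <= 40 * (1 + al) ^ 2 * (1 + b * u ^ 2) ^ 2) ->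
  Rabs (p * heat al t u) <= heat_const.
Proof.
intros Ht; cbv zeta; unfold heat, heat_const; intro Hp.
assert (H := heat_den_pos t Ht).
assert (Hb : 0 < al / (1 + 2 * al * t)) by (apply Rdiv_lt_0_compat; lra).
set (b := al / (1 + 2 * al * t)) in *.
assert (Hw : 0 <= b * u ^ 2) by (apply Rmult_le_pos; [lra|apply pow2_ge_0]).
assert (Hs : 1 <= sqrt (1 + 2 * al * t)) by (apply Rle_trans with (sqrt 1); [rewrite sqrt_1; lra|apply sqrt_le_1_alt; lra]).
assert (Hi : 0 < / sqrt (1 + 2 * al * t) <= 1).
{ split; [apply Rinv_0_lt_compat; lra|apply Rinv_le_1; lra]. }
assert (X := exp_poly_bound _ Hw); assert (P := exp_pos (- (b * u ^ 2))).
rewrite Ropp_mult_distr_l in X, P; unfold Rdiv.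
set (E := exp (- b * u ^ 2)) in *; set (i := / sqrt _) in *.
rewrite !Rabs_mult, (Rabs_pos_eq E), (Rabs_pos_eq i) by lra.
apply Rle_trans with (40 * (1 + al) ^ 2 * (1 + b * u ^ 2) ^ 2 * (E * 1)).
- apply Rmult_le_compat; [apply Rabs_pos|nra|exact Hp|apply Rmult_le_compat_l; lra].
- assert (0 <= (1 + al) ^ 2) by apply pow2_ge_0; nra.
Qed.

(** The last inequality is b (1 - |u|)^2 >= 0 together with b <= al; it controls the odd powers of u
    in [heat1] and [heat3]. *)
Lemma heat_par (t u : R) : 0 <= t -> let b := al / (1 + 2 * al * t) in
  0 < b <= al /\ 0 <= b * u ^ 2 /\ 2 * Rabs (b * u) <= al + b * u ^ 2.
Proof.
intros Ht b; assert (H := heat_den_pos t Ht).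
assert (Hb : 0 < b) by (apply Rdiv_lt_0_compat; lra).
assert (Hb' : b <= al).
{ unfold b, Rdiv; apply Rle_trans with (al * 1); [|lra].
  apply Rmult_le_compat_l; [lra|]; apply Rinv_le_1; lra. }
split; [lra|]; split; [apply Rmult_le_pos; [lra|apply pow2_ge_0]|].
rewrite Rabs_mult, (Rabs_pos_eq b) by lra.
assert (0 <= b * (1 - Rabs u) ^ 2) by (apply Rmult_le_pos; [lra|apply pow2_ge_0]).
assert (Rabs u ^ 2 = u ^ 2) by apply pow2_abs; nra.
Qed.

Lemma heat1_bound (t u : R) : 0 <= t -> Rabs (heat1 al t u) <= heat_const.
Proof.
intro Ht; unfold heat1; apply heat_bound; [exact Ht|].
destruct (heat_par t u Ht) as [Hb [Hw Hu]]; cbv zeta in *.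
set (b := al / (1 + 2 * al * t)) in *; set (w := b * u ^ 2) in *.
replace (- 2 * b * u) with (- (2 * (b * u))) by ring.
rewrite Rabs_Ropp, Rabs_mult, (Rabs_pos_eq 2) by lra; nra.
Qed.

Lemma heat2_bound (t u : R) : 0 <= t -> Rabs (heat2 al t u) <= heat_const.
Proof.
intro Ht; unfold heat2; apply heat_bound; [exact Ht|].
destruct (heat_par t u Ht) as [Hb [Hw Hu]]; cbv zeta in *.
set (b := al / (1 + 2 * al * t)) in *; set (w := b * u ^ 2) in *.
replace (4 * b ^ 2 * u ^ 2 - 2 * b) with (b * (4 * w - 2)) by (unfold w; ring).
rewrite Rabs_mult, (Rabs_pos_eq b) by lra.
apply Rle_trans with ((1 + al) ^ 2 * (40 * (1 + w) ^ 2)); [|right; ring].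
apply Rmult_le_compat; [lra|apply Rabs_pos|nra|apply Rabs_le; nra].
Qed.

Lemma heat3_bound (t u : R) : 0 <= t -> Rabs (heat3 al t u) <= heat_const.
Proof.
intro Ht; unfold heat3; apply heat_bound; [exact Ht|].
destruct (heat_par t u Ht) as [Hb [Hw Hu]]; cbv zeta in *.
set (b := al / (1 + 2 * al * t)) in *; set (w := b * u ^ 2) in *.
replace (12 * b ^ 2 * u - 8 * b ^ 3 * u ^ 3) with (2 * (b * u) * (b * (6 - 4 * w))) by (unfold w; ring).
set (k := b * u) in *.
rewrite !Rabs_mult, (Rabs_pos_eq b), (Rabs_pos_eq 2) by lra.
apply Rle_trans with (((1 + al) * (1 + w)) * ((1 + al) * (40 * (1 + w)))); [|right; ring].
apply Rmult_le_compat; [generalize (Rabs_pos k); lra| |assert (0 <= al * w) by (apply Rmult_le_pos; lra); lra|].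
- apply Rmult_le_pos; [lra|apply Rabs_pos].
- apply Rmult_le_compat; [lra|apply Rabs_pos|lra|apply Rabs_le; lra].
Qed.

Lemma heat4_bound (t u : R) : 0 <= t -> Rabs (heat4 al t u) <= heat_const.
Proof.
intro Ht; unfold heat4; apply heat_bound; [exact Ht|].
destruct (heat_par t u Ht) as [Hb [Hw Hu]]; cbv zeta in *.
set (b := al / (1 + 2 * al * t)) in *; set (w := b * u ^ 2) in *.
replace (12 * b ^ 2 - 48 * b ^ 3 * u ^ 2 + 16 * b ^ 4 * u ^ 4)
  with (b ^ 2 * (12 - 48 * w + 16 * w ^ 2)) by (unfold w; ring).
rewrite Rabs_mult, (Rabs_pos_eq (b ^ 2)) by apply pow2_ge_0.
apply Rle_trans with ((1 + al) ^ 2 * (40 * (1 + w) ^ 2)); [|right; ring].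
apply Rmult_le_compat; [apply pow2_ge_0|apply Rabs_pos|apply pow_incr; lra|apply Rabs_le; nra].
Qed.

Lemma heat_range (t u : R) : 0 <= t -> Rabs (heat al t u) <= 1.
Proof.
intro Ht; destruct (heat_par t u Ht) as [Hb [Hw _]]; cbv zeta in *.
assert (H := heat_den_pos t Ht); unfold heat.
assert (Hs : 1 <= sqrt (1 + 2 * al * t)) by (apply Rle_trans with (sqrt 1); [rewrite sqrt_1; lra|apply sqrt_le_1_alt; lra]).
rewrite Rabs_pos_eq by (apply Rdiv_le_0_compat; [left; apply exp_pos|lra]).
apply Rmult_le_reg_r with (sqrt (1 + 2 * al * t)); [lra|].
unfold Rdiv at 1; rewrite Rmult_assoc, Rinv_l, Rmult_1_r, Rmult_1_l by lra.
apply Rle_trans with (exp 0); [apply exp_le_compat; lra|rewrite exp_0; exact Hs].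
Qed.

Lemma heat_lipschitz_u (t u v : R) : 0 <= t ->
  Rabs (heat al t v - heat al t u) <= heat_const * Rabs (v - u).
Proof.
intro Ht; apply (mean_value_ineq (heat al t) (heat1 al t)); intros x _.
- apply is_derive_heat_u.
- now apply heat1_bound.
Qed.

Lemma heat_lipschitz_t (s t u : R) : 0 <= s -> 0 <= t ->
  Rabs (heat al t u - heat al s u) <= heat_const * Rabs (t - s).
Proof.
intros Hs Ht.
assert (Hr : forall x, Rmin s t <= x <= Rmax s t -> 0 <= x).
{ intros x Hx; apply Rle_trans with (2 := proj1 Hx); now apply Rmin_glb. }
apply (mean_value_ineq (fun t => heat al t u) (fun t => heat2 al t u / 2)); intros x Hx.
- apply is_derive_heat_t; auto.
- assert (H := heat2_bound x u (Hr x Hx)); unfold Rdiv.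
  rewrite Rabs_mult, (Rabs_pos_eq (/ 2)) by lra; generalize (Rabs_pos (heat2 al x u)); lra.
Qed.

Lemma heat2_lipschitz_u (t u v : R) : 0 <= t ->
  Rabs (heat2 al t v - heat2 al t u) <= heat_const * Rabs (v - u).
Proof.
intro Ht; apply (mean_value_ineq (heat2 al t) (heat3 al t)); intros x _.
- apply is_derive_heat2_u.
- now apply heat3_bound.
Qed.

Lemma heat_taylor_u (t u k : R) : 0 <= t ->
  Rabs (heat al t (u + k) - heat al t u - k * heat1 al t u - k ^ 2 / 2 * heat2 al t u)
    <= heat_const * Rabs k ^ 3.
Proof.
intro Ht.
assert (H := taylor_order_2 (heat al t) (heat1 al t) (heat2 al t) (heat3 al t) u (u + k) heat_const).
replace (u + k - u) with k in H by ring; apply H; intros x _.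
- apply is_derive_heat_u.
- apply is_derive_heat1_u.
- apply is_derive_heat2_u.
- now apply heat3_bound.
Qed.

Lemma heat_taylor_t (t u k : R) : 0 <= k <= t ->
  Rabs (heat al (t - k) u - heat al t u + k * (heat2 al t u / 2)) <= heat_const * k ^ 2.
Proof.
intro Hk.
assert (H := taylor_order_1 (fun t => heat al t u) (fun t => heat2 al t u / 2)
  (fun t => heat4 al t u / 2 / 2) t (t - k) heat_const).
replace (t - k - t) with (- k) in H by ring.
rewrite Rabs_Ropp, (Rabs_pos_eq k) in H by lra.
replace (heat al (t - k) u - heat al t u + k * (heat2 al t u / 2))
  with (heat al (t - k) u - heat al t u - - k * (heat2 al t u / 2)) by ring.
assert (Hr : forall x, Rmin t (t - k) <= x <= Rmax t (t - k) -> 0 <= x).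
{ intros x; rewrite Rmin_right by lra; lra. }
apply H; intros x Hx; specialize (Hr x Hx).
- now apply is_derive_heat_t.
- apply (is_derive_ext (fun t => / 2 * heat2 al t u)); [intro; as_R; field|].
  replace (heat4 al x u / 2 / 2) with (/ 2 * (heat4 al x u / 2)) by field.
  apply (is_derive_scal (fun t => heat2 al t u)), is_derive_heat2_t, Hr.
- assert (B := heat4_bound x u Hr); unfold Rdiv.
  rewrite !Rabs_mult, (Rabs_pos_eq (/ 2)) by lra; generalize (Rabs_pos (heat4 al x u)); lra.
Qed.

(* One step of the comparison: [e] is the square root of the mesh. The drift [mu - d]
   and the variance [de = e^2 (d + d^2)] cancel the first two Taylor terms. *)
Lemma heat_step (t0 C : R) : 0 <= t0 -> 0 <= C -> exists K, 0 <= K /\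
  forall e d mu de T U, 0 < e <= 1 -> 0 <= d <= t0 -> 0 <= de <= T -> 0 <= mu ->
  Rabs (mu - d) <= C * e ^ 2 * d -> Rabs (de - e ^ 2 * (d + d ^ 2)) <= C * e ^ 4 * d ->
  Rabs (heat al (T - de) (U - e * mu) - heat al T U + d * (heat al T (U + e) - heat al T U))
    <= K * (e ^ 3 * d).
Proof.
intros Ht0 HC.
assert (HM : 0 <= heat_const) by (unfold heat_const; generalize (pow2_ge_0 (1 + al)); lra).
set (M := heat_const) in *.
(* These give mu <= m d and de <= v e^2 d. The summands of the constant are, in order, those of [B1]
   (Taylor in time), [B2] (drift), [B3] (base point of [heat2]), [B4] (jump by e), [B5] (mismatch of
   the drift) and [B6] (mismatch of the variance). *)
pose (m := 1 + C); pose (v := 1 + t0 + C).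
exists (M * (v ^ 2 * t0 + m ^ 3 * t0 ^ 2 + v * m * t0 + 1 + C + C * (m + 1) * t0 + C)).
assert (Hm : 0 < m) by (unfold m; lra); assert (Hv : 0 < v) by (unfold v; lra).
split.
{ apply Rmult_le_pos; [exact HM|].
  repeat apply Rplus_le_le_0_compat; repeat apply Rmult_le_pos; try lra; apply pow_le; lra. }
intros e d mu de T U He Hd Hde Hmu H1 H2.
assert (He2 : 0 < e ^ 2 <= 1).
{ split; [apply pow_lt; lra|rewrite <- (pow1 2); apply pow_incr; lra]. }
assert (He3 : 0 < e ^ 3) by (apply pow_lt; lra).
assert (He4 : 0 < e ^ 4 <= e ^ 3).
{ split; [apply pow_lt; lra|]. replace (e ^ 4) with (e ^ 3 * e) by ring; nra. }
assert (Hmu' : mu <= m * d).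
{ apply Rabs_le_between in H1; unfold m.
  assert (C * d * e ^ 2 <= C * d * 1) by (apply Rmult_le_compat_l; [apply Rmult_le_pos|]; lra); lra. }
assert (Hde' : de <= v * e ^ 2 * d).
{ apply Rabs_le_between in H2; unfold v.
  assert (0 <= C * e ^ 2 * d) by (repeat apply Rmult_le_pos; lra).
  replace (C * e ^ 4 * d) with (C * e ^ 2 * d * e ^ 2) in H2 by ring.
  assert (e ^ 2 * d * d <= e ^ 2 * d * t0) by (apply Rmult_le_compat_l; [apply Rmult_le_pos|]; lra).
  nra. }
set (X := e ^ 3 * d) in *.
assert (HX : 0 <= X) by (apply Rmult_le_pos; lra).
set (U' := U - e * mu).
assert (B1 : Rabs (heat al (T - de) U' - heat al T U' + de * (heat2 al T U' / 2)) <= M * (v ^ 2 * t0) * X).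
{ eapply Rle_trans; [apply (heat_taylor_t T U' de Hde)|]; fold M.
  rewrite Rmult_assoc; apply Rmult_le_compat_l; [exact HM|].
  apply Rle_trans with ((v * e ^ 2 * d) ^ 2); [apply pow_incr; lra|].
  replace ((v * e ^ 2 * d) ^ 2) with (v ^ 2 * d * (e ^ 4 * d)) by ring.
  apply Rmult_le_compat; [apply Rmult_le_pos; [apply pow2_ge_0|lra]|apply Rmult_le_pos; lra| |].
  - apply Rmult_le_compat_l; [apply pow2_ge_0|lra].
  - apply Rmult_le_compat_r; lra. }
assert (B2 : Rabs (heat al T U' - heat al T U + e * mu * heat1 al T U - (e * mu) ^ 2 / 2 * heat2 al T U)
   <= M * (m ^ 3 * t0 ^ 2) * X).
{ assert (Q := heat_taylor_u T U (- (e * mu)) ltac:(lra)).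
  replace (U + - (e * mu)) with U' in Q by (unfold U'; ring).
  rewrite Rabs_Ropp, (Rabs_pos_eq (e * mu)) in Q by (apply Rmult_le_pos; lra).
  match goal with |- Rabs ?y <= _ => match type of Q with Rabs ?z <= _ => replace y with z by field end end.
  eapply Rle_trans; [exact Q|]; fold M.
  rewrite Rmult_assoc; apply Rmult_le_compat_l; [exact HM|].
  apply Rle_trans with ((e * (m * d)) ^ 3).
  - apply pow_incr; split; [apply Rmult_le_pos; lra|apply Rmult_le_compat_l; lra].
  - replace ((e * (m * d)) ^ 3) with (m ^ 3 * d ^ 2 * X) by (unfold X; ring).
    apply Rmult_le_compat_r; [exact HX|]; apply Rmult_le_compat_l; [apply pow_le; lra|].
    apply pow_incr; lra. }
assert (B3 : Rabs (de / 2 * (heat2 al T U' - heat2 al T U)) <= M * (v * m * t0) * X).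
{ rewrite Rabs_mult, (Rabs_pos_eq (de / 2)) by lra.
  assert (Q := heat2_lipschitz_u T U U' ltac:(lra)); fold M in Q.
  replace (U' - U) with (- (e * mu)) in Q by (unfold U'; ring).
  rewrite Rabs_Ropp, (Rabs_pos_eq (e * mu)) in Q by (apply Rmult_le_pos; lra).
  apply Rle_trans with ((v * e ^ 2 * d) * (M * (e * (m * d)))).
  - apply Rmult_le_compat; [lra|apply Rabs_pos|lra|].
    eapply Rle_trans; [exact Q|]; apply Rmult_le_compat_l; [exact HM|].
    apply Rmult_le_compat_l; lra.
  - replace (v * e ^ 2 * d * (M * (e * (m * d)))) with (M * (v * m * d) * X) by (unfold X; ring).
    apply Rmult_le_compat_r; [exact HX|]; apply Rmult_le_compat_l; [exact HM|].
    apply Rmult_le_compat_l; [apply Rmult_le_pos; lra|lra]. }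
assert (B4 : Rabs (d * (heat al T (U + e) - heat al T U - e * heat1 al T U - e ^ 2 / 2 * heat2 al T U))
   <= M * 1 * X).
{ rewrite Rabs_mult, (Rabs_pos_eq d) by lra.
  assert (Q := heat_taylor_u T U e ltac:(lra)); fold M in Q; rewrite (Rabs_pos_eq e) in Q by lra.
  apply Rle_trans with (d * (M * e ^ 3)); [apply Rmult_le_compat_l; lra|right; unfold X; ring]. }
assert (B5 : Rabs (e * (mu - d) * heat1 al T U) <= M * C * X).
{ rewrite !Rabs_mult, (Rabs_pos_eq e) by lra.
  apply Rle_trans with (e * (C * e ^ 2 * d) * M).
  - apply Rmult_le_compat; [apply Rmult_le_pos; [lra|apply Rabs_pos]|apply Rabs_pos| |].
    + apply Rmult_le_compat_l; lra.
    + apply heat1_bound; lra.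
  - right; unfold X; ring. }
assert (B6 : Rabs ((e ^ 2 * (mu ^ 2 - d ^ 2) - (de - e ^ 2 * (d + d ^ 2))) / 2 * heat2 al T U)
   <= M * (C * (m + 1) * t0 + C) * X).
{ rewrite Rabs_mult.
  apply Rle_trans with ((C * (m + 1) * t0 + C) * X * M); [|right; ring].
  apply Rmult_le_compat; [apply Rabs_pos..| |apply heat2_bound; lra].
  unfold Rdiv; rewrite Rabs_mult, (Rabs_pos_eq (/ 2)) by lra.
  apply Rle_trans with (Rabs (e ^ 2 * (mu ^ 2 - d ^ 2) - (de - e ^ 2 * (d + d ^ 2)))).
  { generalize (Rabs_pos (e ^ 2 * (mu ^ 2 - d ^ 2) - (de - e ^ 2 * (d + d ^ 2)))); lra. }
  unfold Rminus at 1; eapply Rle_trans; [apply Rabs_triang|]; rewrite Rabs_Ropp.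
  rewrite Rmult_plus_distr_r; apply Rplus_le_compat.
  - replace (e ^ 2 * (mu ^ 2 - d ^ 2)) with (e ^ 2 * ((mu - d) * (mu + d))) by ring.
    rewrite !Rabs_mult, (Rabs_pos_eq (e ^ 2)), (Rabs_pos_eq (mu + d)) by lra.
    apply Rle_trans with (e ^ 2 * ((C * e ^ 2 * d) * ((m + 1) * d))).
    + apply Rmult_le_compat_l; [lra|]; apply Rmult_le_compat; [apply Rabs_pos|lra|exact H1|lra].
    + replace (e ^ 2 * (C * e ^ 2 * d * ((m + 1) * d))) with (C * (m + 1) * d * (e ^ 4 * d)) by ring.
      apply Rmult_le_compat; [repeat apply Rmult_le_pos; lra|apply Rmult_le_pos; lra| |].
      * apply Rmult_le_compat_l; [apply Rmult_le_pos|]; lra.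
      * apply Rmult_le_compat_r; lra.
  - eapply Rle_trans; [exact H2|]; rewrite Rmult_assoc; apply Rmult_le_compat_l; [exact HC|].
    apply Rmult_le_compat_r; lra. }
match type of B1 with Rabs ?y1 <= _ => match type of B2 with Rabs ?y2 <= _ =>
match type of B3 with Rabs ?y3 <= _ => match type of B4 with Rabs ?y4 <= _ =>
match type of B5 with Rabs ?y5 <= _ => match type of B6 with Rabs ?y6 <= _ =>
  match goal with |- Rabs ?y <= _ => replace y with (y1 + y2 - y3 + y4 - y5 + y6) by field end
end end end end end end.
apply Rabs_le_between in B1; apply Rabs_le_between in B2; apply Rabs_le_between in B3.
apply Rabs_le_between in B4; apply Rabs_le_between in B5; apply Rabs_le_between in B6.
apply Rabs_le; lra.
Qed.

End Heat.

(** The bound is uniform in c because the inner expectation over s is taken with a shift that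
    depends on r. *)
Lemma gaussian_expectation (al z : R) : 0 < al -> 0 < z < 1 -> exists K, 0 <= K /\
  forall e c, 0 < e <= 1 ->
  Rabs (Mean (exp (- e)) z (fun r => exp (- al * (sqrt e * (INR r + ln (1 - z) / e) + c) ^ 2))
        - heat al (z / (1 - z)) c) <= K * sqrt e.
Proof.
intros Hal Hz; pose (t0 := z / (1 - z)).
assert (Ht0 : 0 < t0) by (apply Rdiv_lt_0_compat; lra).
pose (C := (1 + 2 * t0) * (1 + t0)).
assert (HC1 : 1 + t0 <= C) by (unfold C; nra).
assert (HC0 : 0 <= C) by lra.
destruct (heat_step al Hal t0 C (Rlt_le _ _ Ht0) HC0) as [K [HK Hstep]].
exists (K * t0 * 2); split; [apply Rmult_le_pos; [apply Rmult_le_pos|]; lra|].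
intros e c He; fold t0.
destruct (exp_neg_bounds e He) as [Hq Hi].
set (q := exp (- e)) in *; set (h := sqrt e).
assert (Hh : 0 < h <= 1).
{ unfold h; split; [apply sqrt_lt_R0; lra|]; rewrite <- sqrt_1; apply sqrt_le_1_alt; lra. }
assert (Hh2 : h ^ 2 = e) by (unfold h; apply pow2_sqrt; lra).
pose (s := fun n => INR n * e).
assert (Hs : forall n, 0 <= s n) by (intro n; apply Rmult_le_pos; [apply pos_INR|lra]).
assert (Es : forall n, s (S n) = s n + e) by (intro n; unfold s; rewrite S_INR; ring).
assert (Eq : forall n, q ^ n = exp (- s n)) by (intro n; apply exp_pow_neg).
(* At level n the geometric variables of parameters z, ..., z q^(n-1) are removed: their rescaled
   variance, about t0 - odds, has become heat time, and the centre is the approximate mean of what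
   remains. Level 0 is the given test function. *)
pose (g := fun n r => heat al (t0 - odds z (s n)) (h * (INR r - lam z (s n) / e) + c)).
assert (Ho : forall n, 0 < odds z (s n) <= t0).
{ intro n; unfold t0; rewrite <- odds_0; apply odds_bound; [exact Hz|].
  specialize (Hs n); lra. }
assert (Bg : forall n, bounded_by 1 (g n)).
{ intros n r; apply heat_range; [exact Hal|specialize (Ho n); lra]. }
assert (Hzn : forall n, 0 < z * q ^ n <= z).
{ intro n; rewrite Eq; now apply arg_bound. }
pose (a := fun n => Mean q (z * q ^ n) (g n)).
assert (HM : 0 <= heat_const al) by (unfold heat_const; generalize (pow2_ge_0 (1 + al)); lra).
assert (H : Rabs (a O - heat al t0 c) <= K * t0 * h ^ 3 / (1 - q)).
{ apply telescoping_geom with (1 := Hq).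
  - apply Rmult_le_pos; [apply Rmult_le_pos; lra|apply pow_le; lra].
  - intro n; unfold a; rewrite <- tech_pow_Rmult.
    replace (z * (q * q ^ n)) with (z * q ^ n * q) by ring.
    assert (I1 := lam_increment z (s n) e Hz (Hs n) (proj1 He)).
    assert (I2 := odds_increment z (s n) e Hz (Hs n) (proj1 He)).
    assert (I3 := odds_le_geom z (s n) Hz (Hs n)).
    fold t0 in I1, I2, I3; fold C in I2; rewrite <- Es in I1, I2; rewrite <- Eq in I3.
    assert (On := Ho n); assert (OSn := Ho (S n)).
    assert (L0 := lam_bound z (s (S n)) Hz (Hs (S n))).
    assert (OM : odds z (s (S n)) <= odds z (s n)).
    { apply odds_bound; [exact Hz|rewrite Es; generalize (Hs n); lra]. }
    assert (LM : lam z (s (S n)) <= lam z (s n)).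
    { unfold lam; apply Ropp_le_contravar, ln_le; rewrite <- !Eq.
      - generalize (Hzn n); lra.
      - rewrite <- tech_pow_Rmult; generalize (Hzn n); nra. }
    set (d := odds z (s n)) in *.
    (* Removing one geometric variable lowers the centre by [mu] and the residual rescaled variance
       by [de]; [H1] and [H2] compare them with its mean d and its rescaled variance h^2 (d +
       d^2). *)
    pose (mu := (lam z (s n) - lam z (s (S n))) / e).
    pose (de := d - odds z (s (S n))).
    assert (H1 : Rabs (mu - d) <= C * h ^ 2 * d).
    { rewrite Hh2; unfold mu.
      replace (_ / e - d) with (- (lam z (s (S n)) - lam z (s n) + e * d) * / e) by (field; lra).
      rewrite Rabs_mult, Rabs_Ropp, (Rabs_pos_eq (/ e)) by (left; apply Rinv_0_lt_compat; lra).
      apply Rle_trans with ((1 + t0) * d * e ^ 2 * / e).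
      - apply Rmult_le_compat_r; [left; apply Rinv_0_lt_compat; lra|exact I1].
      - replace ((1 + t0) * d * e ^ 2 * / e) with ((1 + t0) * (e * d)) by (field; lra).
        rewrite Rmult_assoc; apply Rmult_le_compat_r; [apply Rmult_le_pos; lra|exact HC1]. }
    assert (H2 : Rabs (de - h ^ 2 * (d + d ^ 2)) <= C * h ^ 4 * d).
    { replace (h ^ 4) with ((h ^ 2) ^ 2) by ring; rewrite Hh2; unfold de.
      rewrite <- Rabs_Ropp.
      replace (- _) with (odds z (s (S n)) - d + e * (d + d ^ 2)) by ring; lra. }
    apply Mean_step with 1 1; [exact Hq|generalize (Hzn n); lra|apply Bg|apply Bg|].
    intro r; replace (z * q ^ n / (1 - z * q ^ n)) with d by (unfold d, odds; now rewrite Eq).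
    assert (HT := Hstep h d mu de (t0 - odds z (s (S n))) (h * (INR r - lam z (s (S n)) / e) + c)
      Hh ltac:(lra) ltac:(unfold de; lra)
      ltac:(unfold mu; apply Rdiv_le_0_compat; lra) H1 H2).
    unfold g; fold d.
    replace (t0 - odds z (s (S n)) - de) with (t0 - d) in HT by (unfold de; ring).
    replace (h * (INR r - lam z (s (S n)) / e) + c - h * mu)
      with (h * (INR r - lam z (s n) / e) + c) in HT by (unfold mu; field; lra).
    replace (h * (INR r - lam z (s (S n)) / e) + c + h)
      with (h * (INR (S r) - lam z (s (S n)) / e) + c) in HT by (rewrite S_INR; ring).
    eapply Rle_trans; [exact HT|].
    replace (K * t0 * h ^ 3 * q ^ n) with (K * h ^ 3 * (t0 * q ^ n)) by ring.
    rewrite <- Rmult_assoc; apply Rmult_le_compat_l; [|exact I3].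
    apply Rmult_le_pos; [lra|apply pow_le; lra].
  (* For fixed e, as n grows, the law concentrates at 0, the heat time tends to t0, and the shift -
     lam / h tends to 0, h being fixed. *)
  - apply is_lim_seq_spec; intro eps.
    assert (L : is_lim_seq (fun n => 2 * (wt1 q (z * q ^ n) - 1)
        + heat_const al * (t0 * q ^ n) + heat_const al * (t0 * / h * q ^ n)) 0).
    { replace (Finite 0) with (Finite (2 * (1 - 1) + heat_const al * (t0 * 0) + heat_const al * (t0 * / h * 0)))
        by (f_equal; ring).
      repeat apply is_lim_seq_plus'.
      - apply (is_lim_seq_scal_l _ 2 (1 - 1)), is_lim_seq_minus'; [now apply lim_wt1|apply is_lim_seq_const].
      - apply (is_lim_seq_scal_l _ _ (t0 * 0)), (is_lim_seq_scal_l _ _ 0), lim_geom, Hq.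
      - apply (is_lim_seq_scal_l _ _ (t0 * / h * 0)), (is_lim_seq_scal_l _ _ 0), lim_geom, Hq. }
    apply is_lim_seq_spec in L; generalize (L eps); apply filter_imp; intros n Hn.
    rewrite Rminus_0_r in Hn; apply Rabs_def2 in Hn; apply Rle_lt_trans with (2 := proj1 Hn).
    assert (I3 := odds_le_geom z (s n) Hz (Hs n)); fold t0 in I3; rewrite <- Eq in I3.
    assert (I4 := lam_bound z (s n) Hz (Hs n)).
    replace (a n - heat al t0 c) with ((a n - g n O) + (heat al (t0 - odds z (s n)) (h * (INR 0 - lam z (s n) / e) + c)
      - heat al t0 (h * (INR 0 - lam z (s n) / e) + c))
      + (heat al t0 (h * (INR 0 - lam z (s n) / e) + c) - heat al t0 c)) by (unfold g; ring).
    eapply Rle_trans; [apply Rabs_triang|]; apply Rplus_le_compat;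
      [eapply Rle_trans; [apply Rabs_triang|]; apply Rplus_le_compat|].
    + rewrite <- (Rmult_1_r 2) at 1; apply Mean_head; [exact Hq|generalize (Hzn n); lra|apply Bg].
    + eapply Rle_trans; [apply heat_lipschitz_t; [exact Hal|lra|generalize (Ho n); lra]|].
      apply Rmult_le_compat_l; [exact HM|].
      replace (t0 - odds z (s n) - t0) with (- odds z (s n)) by ring.
      rewrite Rabs_Ropp, Rabs_pos_eq; [exact I3|generalize (Ho n); lra].
    + eapply Rle_trans; [apply heat_lipschitz_u; [exact Hal|lra]|].
      apply Rmult_le_compat_l; [exact HM|].
      replace (h * (INR 0 - lam z (s n) / e) + c - c) with (- (lam z (s n) * / h))
        by (rewrite <- Hh2; simpl INR; field; lra).
      assert (0 < / h) by (apply Rinv_0_lt_compat; lra).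
      rewrite Rabs_Ropp, Rabs_pos_eq by (apply Rmult_le_pos; lra).
      replace (t0 * / h * q ^ n) with (t0 * q ^ n * / h) by ring.
      apply Rmult_le_compat_r; lra. }
replace (Mean q z _) with (a O).
2:{ unfold a; simpl pow; rewrite Rmult_1_r; apply Mean_ext; intro r; unfold g, heat, s; simpl INR.
    rewrite Rmult_0_l, odds_0, lam_0; fold t0; rewrite Rminus_diag, Rmult_0_r, Rplus_0_r, sqrt_1.
    unfold Rdiv; rewrite Rinv_1, !Rmult_1_r; f_equal; ring. }
eapply Rle_trans; [exact H|]; unfold Rdiv.
apply Rle_trans with (K * t0 * h ^ 3 * (2 / e)).
- apply Rmult_le_compat_l; [|exact Hi]; apply Rmult_le_pos; [apply Rmult_le_pos; lra|apply pow_le; lra].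
- right; rewrite <- Hh2; field; lra.
Qed.

(** * The saddle point *)

Lemma exp_INR_mult (a : R) (n : nat) : exp (INR n * a) = exp a ^ n.
Proof.
induction n as [|n IH]; [simpl; now rewrite Rmult_0_l, exp_0|].
rewrite S_INR, <- tech_pow_Rmult, <- IH, <- exp_plus; f_equal; ring.
Qed.

(** The inner expectation leaves a Gaussian in v; multiplied by the factor kept aside in
    [gauss_split], it is a Gaussian of rate [al], to which the one-variable theorem applies
    again. *)
Lemma heat_absorb (t v : R) : 0 <= t ->
  let al := 5 / 12 + 31 / (12 * (1 + 6 * t)) in
  exp (- (5 / 12) * v ^ 2) * heat 3 t (sqrt 31 / 6 * v)
  = / sqrt (1 + 6 * t) * exp (- al * v ^ 2).
Proof.
intros Ht al; unfold heat.
replace (1 + 2 * 3 * t) with (1 + 6 * t) by ring.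
assert (Hs : 0 < sqrt (1 + 6 * t)) by (apply sqrt_lt_R0; lra).
replace ((sqrt 31 / 6 * v) ^ 2) with (31 / 36 * v ^ 2)
  by (replace 31 with (sqrt 31 ^ 2) at 1 by (apply pow2_sqrt; lra); field).
unfold Rdiv at 2; rewrite <- Rmult_assoc, <- exp_plus, Rmult_comm.
f_equal; f_equal; unfold al; field; lra.
Qed.

Section Saddle.
Variables x y : R.
Hypotheses (Hx : 0 < x < 1) (Hy : 0 < y < 1).

Let t1 := (1 - x) / x.
Let t2 := (1 - y) / y.
Let al := 5 / 12 + 31 / (12 * (1 + 6 * t2)).

Definition gauss_const : R := / sqrt (1 + 6 * t2) * / sqrt (1 + 2 * al * t1).

Definition gauss (e A B : R) (r s : nat) : R :=
  let rho := INR r + ln x / e + A in let sig := INR s + ln y / (31 * e) + B in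
  exp (- e * (3 * rho ^ 2 + 31 * rho * sig + 93 * sig ^ 2)).

Lemma ratio_x_pos : 0 < t1.
Proof. apply Rdiv_lt_0_compat; lra. Qed.

Lemma ratio_y_pos : 0 < t2.
Proof. apply Rdiv_lt_0_compat; lra. Qed.

Lemma outer_rate_pos : 0 < al.
Proof.
assert (H := ratio_y_pos); unfold al.
assert (0 < 31 / (12 * (1 + 6 * t2))) by (apply Rdiv_lt_0_compat; lra); lra.
Qed.

(** Completing the square in s: 3 r^2 + 31 r s + 93 s^2 = 5/12 r^2 + 93 (s + r/6)^2. As 93 e = 3 (31
    e), the inner Gaussian has rate 3 at mesh 31 e. *)
Lemma gauss_split (e A B : R) (r s : nat) : 0 < e ->
  let v := sqrt e * (INR r + ln x / e + A) in
  gauss e A B r s = exp (- (5 / 12) * v ^ 2) *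
    exp (- (3) * (sqrt (31 * e) * (INR s + ln y / (31 * e)) + (sqrt (31 * e) * B + sqrt 31 / 6 * v)) ^ 2).
Proof.
intros He v; unfold gauss; cbv zeta; rewrite <- exp_plus; f_equal.
set (rho := INR r + ln x / e + A) in *; set (sig0 := INR s + ln y / (31 * e)).
rewrite sqrt_mult by lra.
replace (- e) with (- (sqrt e ^ 2)) by (rewrite pow2_sqrt; lra).
unfold v.
transitivity (- sqrt e ^ 2 * (5 / 12 * rho ^ 2 + 3 * sqrt 31 ^ 2 * (sig0 + B + rho / 6) ^ 2)).
- rewrite (pow2_sqrt 31) by lra; field.
- field.
Qed.

Lemma gauss_range (e A B : R) (r : nat) : 0 < e -> bounded_by 1 (gauss e A B r).
Proof.
intros He s; rewrite gauss_split by exact He; cbv zeta.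
rewrite <- exp_plus, Rabs_pos_eq by (left; apply exp_pos).
rewrite <- exp_0; apply exp_le_compat.
match goal with |- _ * ?p ^ 2 + _ * ?q ^ 2 <= _ =>
  generalize (pow2_ge_0 p) (pow2_ge_0 q) end; lra.
Qed.

(** The condition e <= 1/31 keeps the mesh 31 e of s at most 1. The shifts A and B are scaled by
    sqrt e, so the Lipschitz bound on [heat] absorbs them. *)
Lemma double_expectation (A B : R) : exists K, forall e, 0 < e <= / 31 ->
  Rabs (Mean (exp (- e)) (1 - x) (fun r => Mean (exp (- (31 * e))) (1 - y) (gauss e A B r))
     - gauss_const) <= K * sqrt e.
Proof.
assert (Ht1 := ratio_x_pos); assert (Ht2 := ratio_y_pos); assert (Hal := outer_rate_pos).
destruct (gaussian_expectation 3 (1 - y) ltac:(lra) ltac:(lra)) as [K2 [HK2 H2]].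
destruct (gaussian_expectation al (1 - x) Hal ltac:(lra)) as [K1 [HK1 H1]].
assert (HM3 : 0 <= heat_const 3) by (unfold heat_const; lra).
assert (HMa : 0 <= heat_const al) by (unfold heat_const; generalize (pow2_ge_0 (1 + al)); lra).
exists (sqrt 31 * K2 + heat_const 3 * (sqrt 31 * Rabs B) + (K1 + heat_const al * Rabs A)).
intros e He.
specialize (H2 (31 * e)); specialize (H1 e (sqrt e * A) ltac:(lra)).
replace (1 - (1 - x)) with x in H1 by ring; fold t1 in H1.
destruct (exp_neg_bounds e ltac:(lra)) as [Hq _].
destruct (exp_neg_bounds (31 * e) ltac:(lra)) as [HQ _].
assert (Hse : 0 < sqrt e) by (apply sqrt_lt_R0; lra).
assert (Hs31 : 0 < sqrt 31) by (apply sqrt_lt_R0; lra).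
assert (Es : sqrt (31 * e) = sqrt 31 * sqrt e) by (apply sqrt_mult; lra).
set (c := / sqrt (1 + 6 * t2)).
assert (Hc : 0 < c <= 1).
{ unfold c; split; [apply Rinv_0_lt_compat, sqrt_lt_R0; lra|apply Rinv_le_1].
  apply Rle_trans with (sqrt 1); [rewrite sqrt_1; lra|apply sqrt_le_1_alt; lra]. }
pose (v := fun r => sqrt e * (INR r + ln x / e + A)).
pose (f := fun r => c * exp (- al * (sqrt e * (INR r + ln x / e) + sqrt e * A) ^ 2)).
assert (Ev : forall r, v r = sqrt e * (INR r + ln x / e) + sqrt e * A) by (intro; unfold v; ring).
assert (D1 : Rabs (Mean (exp (- e)) (1 - x) (fun r => Mean (exp (- (31 * e))) (1 - y) (gauss e A B r))
   - Mean (exp (- e)) (1 - x) f) <= (sqrt 31 * K2 + heat_const 3 * (sqrt 31 * Rabs B)) * sqrt e).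
{ apply Mean_dist with 1 1; [exact Hq|lra| | |].
  - intro r; apply Mean_le; [exact HQ|lra|apply gauss_range; lra].
  - intro r; unfold f; rewrite Rabs_pos_eq by (apply Rmult_le_pos; [lra|left; apply exp_pos]).
    assert (exp (- al * (sqrt e * (INR r + ln x / e) + sqrt e * A) ^ 2) <= 1).
    { rewrite <- exp_0; apply exp_le_compat.
      assert (0 <= al * (sqrt e * (INR r + ln x / e) + sqrt e * A) ^ 2)
        by (apply Rmult_le_pos; [lra|apply pow2_ge_0]); lra. }
    generalize (exp_pos (- al * (sqrt e * (INR r + ln x / e) + sqrt e * A) ^ 2)); nra.
  - intro r; unfold f; rewrite <- Ev; unfold c, al; rewrite <- heat_absorb by lra.
    rewrite (Mean_ext _ _ _ _ (fun s => gauss_split e A B r s (proj1 He))); cbv zeta; fold (v r).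
    rewrite Mean_scal, <- Rmult_minus_distr_l, Rabs_mult.
    set (w := sqrt 31 / 6 * v r).
    specialize (H2 (sqrt (31 * e) * B + w) ltac:(lra)).
    replace (1 - (1 - y)) with y in H2 by ring; fold t2 in H2.
    assert (L := heat_lipschitz_u 3 ltac:(lra) t2 w (sqrt (31 * e) * B + w) ltac:(lra)).
    replace (sqrt (31 * e) * B + w - w) with (sqrt (31 * e) * B) in L by ring.
    rewrite Rabs_mult, (Rabs_pos_eq (sqrt (31 * e))) in L by apply sqrt_pos.
    
    rewrite Rabs_pos_eq by (left; apply exp_pos).
    assert (P : exp (- (5 / 12) * v r ^ 2) <= 1).
    { rewrite <- exp_0; apply exp_le_compat; generalize (pow2_ge_0 (v r)); lra. }
    rewrite Es in *.
    match goal with |- _ * Rabs (?X - ?Z) <= _ => match type of L with Rabs (?Y - Z) <= _ =>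
      assert (T : Rabs (X - Z) <= Rabs (X - Y) + Rabs (Y - Z))
        by (replace (X - Z) with ((X - Y) + (Y - Z)) by ring; apply Rabs_triang) end end.
    match goal with |- ?p * ?u <= _ => assert (p * u <= 1 * u)
      by (apply Rmult_le_compat_r; [apply Rabs_pos|exact P]) end.
    lra. }
assert (D2 : Rabs (Mean (exp (- e)) (1 - x) f - gauss_const) <= (K1 + heat_const al * Rabs A) * sqrt e).
{ unfold f; rewrite Mean_scal.
  replace gauss_const with (c * heat al t1 0).
  2:{ unfold gauss_const, heat, c, Rdiv; rewrite pow_i, Rmult_0_r, exp_0, Rmult_1_l by lia; reflexivity. }
  rewrite <- Rmult_minus_distr_l, Rabs_mult, (Rabs_pos_eq c) by lra.
  assert (L := heat_lipschitz_u al Hal t1 0 (sqrt e * A) ltac:(lra)).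
  rewrite Rminus_0_r, Rabs_mult, (Rabs_pos_eq (sqrt e)) in L by lra.
  match goal with |- _ * Rabs (?X - ?Z) <= _ => match type of L with Rabs (?Y - Z) <= _ =>
    assert (T : Rabs (X - Z) <= Rabs (X - Y) + Rabs (Y - Z))
      by (replace (X - Z) with ((X - Y) + (Y - Z)) by ring; apply Rabs_triang) end end.
  match goal with |- ?p * ?u <= _ => assert (p * u <= 1 * u)
    by (apply Rmult_le_compat_r; [apply Rabs_pos|lra]) end.
  lra. }
match goal with |- Rabs (?X - ?Z) <= _ => match type of D2 with Rabs (?Y - Z) <= _ =>
  replace (X - Z) with ((X - Y) + (Y - Z)) by ring end end.
eapply Rle_trans; [apply Rabs_triang|]; lra.
Qed.

Hypotheses (Hz : 1 - x = x ^ 6 * y) (Hw : 1 - y = x ^ 31 * y ^ 6).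

Lemma ln_z : ln (1 - x) = 6 * ln x + ln y.
Proof.
rewrite Hz, ln_mult, ln_pow by (try apply pow_lt; lra); simpl INR; ring.
Qed.

Lemma ln_w : ln (1 - y) = 31 * ln x + 6 * ln y.
Proof.
rewrite Hw, ln_mult, !ln_pow by (try apply pow_lt; lra); simpl INR; ring.
Qed.

(** An exact identity. The pair (u0, v0) solves 6 u0 + 31 v0 = A, 31 u0 + 186 v0 = B, of determinant
    155, and so absorbs the linear part of the exponent; the cross terms 6 ln x + ln y and 31 ln x +
    6 ln y are ln (1 - x) and ln (1 - y) by the saddle equations. *)
Lemma F_factor (a b : Q) (e : R) : 0 < e ->
  let A := Q2R a in let B := Q2R b in
  let u0 := (186 * A - 31 * B) / 155 in let v0 := (6 * B - 31 * A) / 155 in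
  F a b (exp (- e)) =
    exp (A * ln x + B * ln y / 31 + e * (3 * u0 ^ 2 + 31 * u0 * v0 + 93 * v0 ^ 2)
      + (3 * ln x ^ 2 + ln x * ln y + 3 / 31 * ln y ^ 2) / e)
    * wt1 (exp (- e)) (1 - x) * wt1 (exp (- (31 * e))) (1 - y)
    * Mean (exp (- e)) (1 - x) (fun r => Mean (exp (- (31 * e))) (1 - y) (gauss e u0 v0 r)).
Proof.
intros He A B u0 v0; set (C := exp (A * ln x + _ + _ + _)).
set (q := exp (- e)); set (Q := exp (- (31 * e))).
assert (EQ : q ^ 31 = Q).
{ unfold q, Q; rewrite exp_pow_neg; f_equal; simpl INR; ring. }
assert (Hterm : forall r s, F_term a b q r s =
  C * (((1 - x) ^ r / qpoch q q r) * ((1 - y) ^ s / qpoch Q Q s * gauss e u0 v0 r s))).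
{ intros r s; unfold F_term; rewrite EQ; fold A B.
  assert (E1 : (1 - x) ^ r = exp (INR r * (6 * ln x + ln y))).
  { rewrite exp_INR_mult, <- ln_z, exp_ln by lra; reflexivity. }
  assert (E2 : (1 - y) ^ s = exp (INR s * (31 * ln x + 6 * ln y))).
  { rewrite exp_INR_mult, <- ln_w, exp_ln by lra; reflexivity. }
  assert (E3 : Rpower q (3 * INR r ^ 2 + 31 * INR r * INR s + 93 * INR s ^ 2 + A * INR r + B * INR s)
    = C * ((1 - x) ^ r * ((1 - y) ^ s * gauss e u0 v0 r s))).
  { rewrite E1, E2; unfold C, gauss, Rpower, q; cbv zeta; rewrite ln_exp, <- !exp_plus; f_equal.
    unfold u0, v0; field; lra. }
  rewrite E3; unfold Rdiv; rewrite Rinv_mult; ring. }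
assert (Hq : 0 < q < 1).
{ unfold q; split; [apply exp_pos|rewrite <- exp_0; apply exp_increasing; lra]. }
assert (HQ : 0 < Q < 1).
{ unfold Q; split; [apply exp_pos|rewrite <- exp_0; apply exp_increasing; lra]. }
assert (W1 := wt1_ge_1 q (1 - x) Hq ltac:(lra)).
assert (W2 := wt1_ge_1 Q (1 - y) HQ ltac:(lra)).
unfold F.
transitivity (Series (fun r => C * wt1 Q (1 - y) * ((1 - x) ^ r / qpoch q q r * Mean Q (1 - y) (gauss e u0 v0 r)))).
- apply Series_ext; intro r.
  rewrite (Series_ext (fun s => F_term a b q r s) _ (Hterm r)), !Series_scal_l.
  change (Series (fun s => (1 - y) ^ s / qpoch Q Q s * gauss e u0 v0 r s)) with (wt Q (1 - y) (gauss e u0 v0 r)).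
  unfold Mean; field; split; [lra|apply Rgt_not_eq, qpoch_pos, Hq].
- rewrite Series_scal_l.
  set (g := fun r => Mean Q (1 - y) (gauss e u0 v0 r)).
  change (C * wt1 Q (1 - y) * wt q (1 - x) g
    = C * wt1 q (1 - x) * wt1 Q (1 - y) * (wt q (1 - x) g / wt1 q (1 - x))).
  field; lra.
Qed.

(** In [F_factor] the terms in 1 / e add up to V / e, the half-logarithms of the normalising sums
    give (x y)^(-1/2), and the quadratic form at (u0, v0) carries a factor e, hence tends to 0. *)
Lemma F_asymptotic (a b : Q) (V : R) :
  Li2 (1 - x) + Li2 (1 - y) / 31 + 3 * ln x ^ 2 + ln x * ln y + 3 / 31 * ln y ^ 2 = V ->
  filterlim (fun e => F a b (exp (- e)) * exp (- (V / e))) (at_right 0)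
    (locally (exp (Q2R a * ln x + Q2R b * ln y / 31 - (ln x + ln y) / 2) * gauss_const)).
Proof.
intros HV.
set (A := Q2R a); set (B := Q2R b).
pose (u0 := (186 * A - 31 * B) / 155); pose (v0 := (6 * B - 31 * A) / 155).
pose (k := 3 * u0 ^ 2 + 31 * u0 * v0 + 93 * v0 ^ 2).
destruct (ln_wt1_asymptotic (1 - x) ltac:(lra)) as [K1 H1].
destruct (ln_wt1_asymptotic (1 - y) ltac:(lra)) as [K2 H2].
destruct (double_expectation u0 v0) as [K3 H3].
replace (1 - (1 - x)) with x in H1 by ring; replace (1 - (1 - y)) with y in H2 by ring.
pose (d1 := fun e => ln (wt1 (exp (- e)) (1 - x)) - (Li2 (1 - x) / e - ln x / 2)).
pose (d2 := fun e => ln (wt1 (exp (- (31 * e))) (1 - y)) - (Li2 (1 - y) / (31 * e) - ln y / 2)).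
assert (Hloc : at_right 0 (fun e => 0 < e <= / 31)).
{ assert (P : 0 < / 31) by lra; exists (mkposreal _ P); intros e He He0.
  unfold ball in He; simpl in He; unfold AbsRing_ball, abs, minus, plus, opp in He; simpl in He.
  apply Rabs_def2 in He; lra. }
assert (Hc : forall h : R -> R, continuous h 0 -> filterlim h (at_right 0) (locally (h 0))).
{ intros h Hh; apply filterlim_filter_le_1 with (2 := Hh); apply filter_le_within. }
assert (Hlin : forall K, filterlim (fun e => K * e) (at_right 0) (locally 0)).
{ intro K; replace 0 with (K * 0) at 2 by ring; apply (Hc (fun e => K * e)).
  apply (ex_derive_continuous (fun e => K * e)); auto_derive; trivial. }
assert (L1 : filterlim d1 (at_right 0) (locally 0)).
{ apply (filterlim_squeeze (at_right 0) d1 (fun e => K1 * e)); [|apply Hlin].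
  revert Hloc; apply filter_imp; intros e He; rewrite Rminus_0_r; exact (H1 e ltac:(lra)). }
assert (L2 : filterlim d2 (at_right 0) (locally 0)).
{ apply (filterlim_squeeze (at_right 0) d2 (fun e => K2 * 31 * e)); [|apply Hlin].
  revert Hloc; apply filter_imp; intros e He; rewrite Rminus_0_r, Rmult_assoc; exact (H2 (31 * e) ltac:(lra)). }
pose (E := fun e => Mean (exp (- e)) (1 - x) (fun r => Mean (exp (- (31 * e))) (1 - y) (gauss e u0 v0 r))).
assert (L3 : filterlim E (at_right 0) (locally gauss_const)).
{ apply (filterlim_squeeze (at_right 0) E (fun e => K3 * sqrt e)).
  - revert Hloc; apply filter_imp; intros e He; exact (H3 e ltac:(lra)).
  - replace 0 with (K3 * sqrt 0) at 2 by (rewrite sqrt_0; ring); apply (Hc (fun e => K3 * sqrt e)).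
    apply (continuous_scal_r K3 sqrt), continuous_sqrt. }
apply (filterlim_ext_loc
  (fun e => exp (A * ln x + B * ln y / 31 - (ln x + ln y) / 2 + (k * e + (d1 e + d2 e))) * E e)).
- revert Hloc; apply filter_imp; intros e He.
  rewrite F_factor by lra; cbv zeta; fold A B; fold u0 v0; fold k; fold (E e).
  destruct (exp_neg_bounds e ltac:(lra)) as [Hq _].
  destruct (exp_neg_bounds (31 * e) ltac:(lra)) as [HQ _].
  assert (W1 := wt1_ge_1 _ (1 - x) Hq ltac:(lra)).
  assert (W2 := wt1_ge_1 _ (1 - y) HQ ltac:(lra)).
  rewrite <- (exp_ln (wt1 (exp (- e)) (1 - x))) by lra.
  rewrite <- (exp_ln (wt1 (exp (- (31 * e))) (1 - y))) by lra.
  match goal with |- ?l = ?c * ?p * ?q * E e * ?t => replace (c * p * q * E e * t) with (c * p * q * t * E e) by ring end.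
  f_equal; rewrite <- !exp_plus; f_equal; unfold d1, d2; rewrite <- HV; field; lra.
- apply filterlim_Rmult; [apply at_right_proper_filter| |exact L3].
  set (m := A * ln x + B * ln y / 31 - (ln x + ln y) / 2).
  assert (LM : filterlim (fun e => m + (k * e + (d1 e + d2 e))) (at_right 0)
    (locally (m + (0 + (0 + 0))))).
  { apply filterlim_Rplus; [apply at_right_proper_filter|apply filterlim_const|].
    apply filterlim_Rplus; [apply at_right_proper_filter|apply Hlin|].
    apply filterlim_Rplus; [apply at_right_proper_filter|exact L1|exact L2]. }
  replace (m + (0 + (0 + 0))) with m in LM by ring.
  apply (filterlim_comp _ _ _ _ exp _ _ _ LM), continuous_exp.
Qed.

End Saddle.

(** * Exponent and amplitude at the saddle *)

Lemma saddle_exponent (x y : R) : 0 < x < 1 -> 0 < y < 1 ->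
  1 - x = x ^ 6 * y -> 1 - y = x ^ 31 * y ^ 6 ->
  31 * rogers (1 - x) + rogers (1 - y) = 8 * (PI ^ 2 / 6) ->
  Li2 (1 - x) + Li2 (1 - y) / 31 + 3 * ln x ^ 2 + ln x * ln y + 3 / 31 * ln y ^ 2
  = 4 * PI ^ 2 / 93.
Proof.
intros Hx Hy Hz Hw H.
assert (Lz := ln_z x y Hx Hy Hz); assert (Lw := ln_w x y Hx Hy Hw).
unfold rogers in H.
replace (1 - (1 - x)) with x in H by ring; replace (1 - (1 - y)) with y in H by ring.
(* The logarithmic products in the Rogers dilogarithms become 93 (ln x)^2 + 31 ln x ln y + 3 (ln
   y)^2, which is 31 times the quadratic part of the exponent. *)
rewrite Lz, Lw in H; lra.
Qed.

(** (1 + 6 t2)(1 + 2 al t1) = 1 + 6 t1 + 6 t2 + 5 t1 t2 is the determinant of the identity plus the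
    Hessian with rows (6, 31), (31, 186) times the covariance diag (t1, t2 / 31); multiplied by x y
    it is 5 + x + y - 6 x y. *)
Lemma amplitude_one (x y S : R) : 0 < x < 1 -> 0 < y < 1 -> 0 < S ->
  S ^ 2 = 5 + x + y - 6 * x * y -> exp (- (ln x + ln y) / 2) * gauss_const x y * S = 1.
Proof.
intros Hx Hy HS E.
assert (E1 : exp (- (ln x + ln y) / 2) = / sqrt (x * y)).
{ assert (Hs : 0 < sqrt (x * y)) by (apply sqrt_lt_R0; nra).
  rewrite <- (exp_ln (/ sqrt (x * y))) by now apply Rinv_0_lt_compat.
  f_equal; rewrite ln_Rinv, <- Rpower_sqrt by nra; unfold Rpower.
  rewrite ln_exp, ln_mult by lra; field. }
assert (P2 := ratio_y_pos y Hy); assert (P1 := ratio_x_pos x Hx); assert (Pa := outer_rate_pos x y Hx Hy).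
unfold gauss_const; rewrite E1, <- !Rinv_mult.
set (t1 := (1 - x) / x) in *; set (t2 := (1 - y) / y) in *.
set (al := 5 / 12 + 31 / (12 * (1 + 6 * t2))) in *.
assert (0 < al * t1) by now apply Rmult_lt_0_compat.
rewrite <- !sqrt_mult by nra.
replace (x * y * ((1 + 6 * t2) * (1 + 2 * al * t1))) with (S ^ 2).
- rewrite sqrt_pow2 by lra; field; lra.
- rewrite E; unfold al; replace ((1 + 6 * t2) * (1 + 2 * (5 / 12 + 31 / (12 * (1 + 6 * t2))) * t1))
    with ((1 + 6 * t2) * (1 + 5 / 6 * t1) + 31 / 6 * t1) by (field; lra).
  unfold t1, t2; field; lra.
Qed.

Theorem proposition6p1 :
  equiv_at_0_right
    (fun eps : R => exp (eps / 3) * S31 (exp (- eps)))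
    (fun eps : R => exp (4 * PI ^ 2 / (93 * eps))).
Proof.
destruct saddle_exists as [x [Hx E3]].
assert (Hx1 : 0 < x < 1) by lra.
(* This is (1 - x) / x^6 in the basis 1, x, x^2; the coefficients are integers because x is a unit,
   the cubic having constant term 1. *)
pose (y := 1646 - 2479 * x + 469 * x ^ 2).
assert (Hx2 : 0.77812383773680 ^ 2 < x ^ 2 < 0.77812383773681 ^ 2) by (split; nra).
assert (Hy : 0 < y < 1) by (unfold y; lra).
assert (E4 : x ^ 4 = 23 * x ^ 2 - 11 * x - 5)
  by (replace (x ^ 4) with (x * x ^ 3) by ring; rewrite E3; lra).
assert (E5 : x ^ 5 = 104 * x ^ 2 - 51 * x - 23)
  by (replace (x ^ 5) with (x * x ^ 4) by ring; rewrite E4; lra).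
assert (E6 : x ^ 6 = 469 * x ^ 2 - 231 * x - 104)
  by (replace (x ^ 6) with (x * x ^ 5) by ring; rewrite E5; lra).
assert (Hz : 1 - x = x ^ 6 * y) by (unfold y; rewrite E6; lra).
assert (Hw : 1 - y = x ^ 31 * y ^ 6).
(* The factor x^5 completes the sixth power (x^6 y)^6 = (1 - x)^6, which leaves only small degrees
   to reduce. *)
{ apply Rmult_eq_reg_l with (x ^ 5); [|apply pow_nonzero; lra].
  replace (x ^ 5 * (x ^ 31 * y ^ 6)) with ((x ^ 6 * y) ^ 6) by ring.
  rewrite <- Hz, E5; unfold y; lra. }
assert (HV := saddle_exponent x y Hx1 Hy Hz Hw).
assert (HR := rogers_saddle x Hx E3).
replace (- 1645 + 2479 * x - 469 * x ^ 2) with (1 - y) in HR by (unfold y; ring).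
specialize (HV HR).
assert (L := fun a b => F_asymptotic x y Hx1 Hy Hz Hw a b _ HV).
assert (P1 : x ^ 3 * y = - 38 + 58 * x - 11 * x ^ 2) by (rewrite E3; unfold y; lra).
assert (P2 : x ^ 16 * y ^ 3 = 18 - 27 * x + 5 * x ^ 2).
{ apply Rmult_eq_reg_l with (x ^ 2); [|apply pow_nonzero; lra].
  replace (x ^ 2 * (x ^ 16 * y ^ 3)) with ((x ^ 6 * y) ^ 3) by ring.
  rewrite <- Hz; lra. }
(* This is 1 + x^3 y - x^16 y^3, by [P1] and [P2]. *)
pose (S := - 55 + 85 * x - 16 * x ^ 2).
assert (A := amplitude_one x y S Hx1 Hy ltac:(unfold S; lra) ltac:(unfold S, y; lra)).
set (G := gauss_const x y) in *.
(* In the three pairs (a, b) the second entry is 31 m with m = 0, 1, 3, so the amplitudes are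
   monomials in x and y. *)
assert (Gexp : forall n m : nat, exp (INR n * ln x + 31 * INR m * ln y / 31 - (ln x + ln y) / 2)
   = x ^ n * y ^ m * exp (- (ln x + ln y) / 2)).
{ intros n m; rewrite <- (exp_ln x), <- (exp_ln y) at 3 by lra.
  rewrite <- !exp_INR_mult, <- !exp_plus; f_equal; field. }
assert (Hc : forall h : R -> R, continuous h 0 -> filterlim h (at_right 0) (locally (h 0))).
{ intros h Hh; apply filterlim_filter_le_1 with (2 := Hh); apply filter_le_within. }
assert (C1 : filterlim (fun e => exp (e / 3)) (at_right 0) (locally 1)).
{ replace 1 with (exp (0 / 3)) by (unfold Rdiv; rewrite Rmult_0_l; apply exp_0).
  apply (Hc (fun e => exp (e / 3))), (ex_derive_continuous (fun e => exp (e / 3))); auto_derive; trivial. }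
assert (Cq : forall c n, filterlim (fun e => c * exp (- e) ^ n) (at_right 0) (locally c)).
{ intros c n; assert (H := Hc (fun e => c * exp (- e) ^ n)); cbv beta in H.
  rewrite Ropp_0, exp_0, pow1, Rmult_1_r in H.
  apply H, (ex_derive_continuous (fun e => c * exp (- e) ^ n)); auto_derive; trivial. }
(* Each series is divided by the common exponential; the powers of q and exp (e / 3) tend to 1, so
   the limit is the signed sum of the amplitudes. *)
assert (T : filterlim (fun e => exp (e / 3) *
    (F 0%Q 0%Q (exp (- e)) * exp (- (4 * PI ^ 2 / 93 / e))
     + 1 * exp (- e) ^ 2 * (F 3%Q 31%Q (exp (- e)) * exp (- (4 * PI ^ 2 / 93 / e)))
     + -1 * exp (- e) ^ 22 * (F 16%Q 93%Q (exp (- e)) * exp (- (4 * PI ^ 2 / 93 / e)))))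
  (at_right 0) (locally (1 * (x ^ 0 * y ^ 0 * exp (- (ln x + ln y) / 2) * G
     + 1 * (x ^ 3 * y ^ 1 * exp (- (ln x + ln y) / 2) * G)
     + -1 * (x ^ 16 * y ^ 3 * exp (- (ln x + ln y) / 2) * G))))).
{ rewrite <- !Gexp.
  assert (FF := at_right_proper_filter 0).
  apply filterlim_Rmult; [exact _|exact C1|].
  repeat (apply filterlim_Rplus; [exact _| |]); repeat (apply filterlim_Rmult; [exact _|apply Cq|]).
  - generalize (L 0%Q 0%Q); unfold Q2R; simpl.
    match goal with |- filterlim ?f _ (locally (exp ?u * _)) -> filterlim _ _ (locally (exp ?w * _)) =>
      replace u with w by field end; trivial.
  - generalize (L 3%Q 31%Q); unfold Q2R; simpl.
    match goal with |- filterlim ?f _ (locally (exp ?u * _)) -> filterlim _ _ (locally (exp ?w * _)) =>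
      replace u with w by field end; trivial.
  - generalize (L 16%Q 93%Q); unfold Q2R; simpl.
    match goal with |- filterlim ?f _ (locally (exp ?u * _)) -> filterlim _ _ (locally (exp ?w * _)) =>
      replace u with w by field end; trivial. }
match type of T with filterlim _ _ (locally ?u) => replace u with 1 in T end.
2:{ transitivity (exp (- (ln x + ln y) / 2) * G * S); [symmetry; exact A|].
    rewrite pow_1, P1, P2; unfold S; ring. }
unfold equiv_at_0_right; revert T; apply filterlim_ext_loc.
assert (P : 0 < 1) by lra; exists (mkposreal _ P); intros e _ He.
unfold S31; replace (4 * PI ^ 2 / (93 * e)) with (4 * PI ^ 2 / 93 / e) by (field; lra).
set (X := exp (- e)); rewrite exp_Ropp; field; apply Rgt_not_eq, exp_pos.
Qed.
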